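(* Let $A\in\mathbb{R}^{d_1\times d_2}$, $d=\max\{d_1,d_2\}$, $n>0$, and let $1\le r<d$ with $\sigma_r(A)>\sigma_{r+1}(A)$. Let the entries $\omega_{ij}$ of $\Omega$ be independent Bernoulli variables with $\mathbb{P}(\omega_{ij}=1)=p_{ij}$, where $$p_{ij}=\min\left\{\frac{n}{2}\left(\frac{a_{ij}^2}{\|A\|_{\mathrm F}^2}+\frac{|a_{ij}|}{\|A\|_{\ell_1}}\right),1\right\}.$$ Then there exist numerical constants $C_1,C_2>0$ such that for any $\alpha>0$, $$\|[\mathcal P_\Omega(A)]_r-A_r\|_{\mathrm F}\le C_1\|A\|_{\mathrm F}\sqrt{\frac{rd}{n}}\left(1+\frac{\sqrt{\sigma_{r+1}(A)\sigma_1(A)}}{\sigma_r(A)-\sigma_{r+1}(A)}\right)$$ with probability at least $1-d^{-\alpha}$, provided that $$n\ge C_2 d\max\left\{(1+\alpha)\log d,\ \frac{\|A\|_{\mathrm F}^2}{(\sigma_r(A)-\sigma_{r+1}(A))^2}\right\}.$$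
   Context: $\mathcal P_\Omega(A)$ denotes the $d_1\times d_2$ matrix with entries $a_{ij}\omega_{ij}/p_{ij}$, with the convention $0/0=0$. For a matrix $M$, $\sigma_1(M)\ge\sigma_2(M)\ge\cdots$ are its singular values and $M_r$ is its best rank-$r$ approximation (truncated SVD). $\|A\|_{\ell_1}=\sum_{i,j}|a_{ij}|$, $\|\cdot\|_{\mathrm F}$ is the Frobenius norm. *)

(* Defs.v *)
From HB Require Import structures.
From mathcomp Require Import all_boot all_order all_algebra.
From Stdlib Require ClassicalEpsilon.
From mathcomp Require Import boolp reals exp.
Set Implicit Arguments. Unset Strict Implicit. Unset Printing Implicit Defensive.
Import Order.TTheory GRing.Theory Num.Theory.
Local Open Scope ring_scope.

Section Defs.
Variable R : realType.

Definition frob (m n : nat) (A : 'M[R]_(m, n)) : R :=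
  Num.sqrt (\sum_i \sum_j A i j ^+ 2).
Definition l1norm (m n : nat) (A : 'M[R]_(m, n)) : R :=
  \sum_i \sum_j `|A i j|.

Definition orthogonal_mx (n : nat) (U : 'M[R]_n) : Prop := U *m U^T = 1%:M.

Definition is_svd (m n : nat) (A : 'M[R]_(m, n)) (U : 'M[R]_m) (V : 'M[R]_n)
    (s : nat -> R) : Prop :=
  [/\ orthogonal_mx U /\ orthogonal_mx V,
      (forall k, 0 <= s k), (forall k, s k.+1 <= s k),
      (forall k, (minn m n <= k)%N -> s k = 0) &
      A = U *m (\matrix_(i < m, j < n) if (i : nat) == j then s i else 0) *m V^T].

Definition svals (m n : nat) (A : 'M[R]_(m, n)) : nat -> R :=
  ClassicalEpsilon.epsilon (inhabits (fun _ : nat => 0))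
    (fun s => exists U V, is_svd A U V s).

(* sigma A k = sigma_k(A), for k >= 1 (1-indexed as in the paper) *)
Definition sigma (m n : nat) (A : 'M[R]_(m, n)) (k : nat) : R := svals A k.-1.

Definition best_rank_approx (m n r : nat) (M B : 'M[R]_(m, n)) : Prop :=
  (\rank B <= r)%N /\
  forall B' : 'M[R]_(m, n), (\rank B' <= r)%N -> frob (M - B) <= frob (M - B').

Definition samp_prob (m n : nat) (A : 'M[R]_(m, n)) (nn : R) (i : 'I_m) (j : 'I_n) : R :=
  Num.min (nn / 2 * (A i j ^+ 2 / frob A ^+ 2 + `|A i j| / l1norm A)) 1.

(* P_Omega(A), with 0/0 = 0 (MathComp's x / 0 = 0) *)
Definition P_Omega (m n : nat) (A : 'M[R]_(m, n)) (p : 'I_m -> 'I_n -> R)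
    (w : {ffun 'I_m * 'I_n -> bool}) : 'M[R]_(m, n) :=
  \matrix_(i, j) (if w (i, j) then A i j / p i j else 0).

(* probability of event E when the entries of Omega are independent
   Bernoulli(p_ij): exact product distribution on the finite sample space *)
Definition bern_prob (m n : nat) (p : 'I_m -> 'I_n -> R)
    (E : {ffun 'I_m * 'I_n -> bool} -> Prop) : R :=
  \sum_(w : {ffun 'I_m * 'I_n -> bool})
    (\prod_(ij : 'I_m * 'I_n) (if w ij then p ij.1 ij.2 else 1 - p ij.1 ij.2)) *
    (if `[< E w >] then 1 else 0).

End Defs.

(* Main.v *)
Require Import Defs.
From HB Require Import structures.
From mathcomp Require Import all_boot all_order all_algebra.
From mathcomp Require Import boolp reals sequences exp ring lra zify.
From mathcomp Require classical_sets functions topology normedtype derive.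
Import Order.TTheory GRing.Theory Num.Theory.
Local Open Scope ring_scope.
Set Implicit Arguments.
Unset Strict Implicit.
Unset Printing Implicit Defensive.

(** The error matrix [E = P_Omega(A) - A], divided by [L = 2 d |A|_F / n], has
    independent centred entries bounded by 1 with variance at most [q / d], where
    [q = n / (2 d)].  Its norm is bounded without logarithmic loss by the moment
    method, in the manner of Bandeira and van Handel: in the expansion of
    [E tr (X X^T)^k] over closed walks of length [2k], [k ~ q], only walks using
    each edge at least twice survive, and a walk visiting [v] vertices contributes
    at most [(q / d)^(v - 1)].  Grouping walks by shape, this is at most [d / k]
    times the same moment of a [2k x 2k] matrix with i.i.d. centred two-point
    entries, whose norm is of order [sqrt k] by a net argument.  Markov's
    inequality then gives [||E|| <= C |A|_F sqrt(d / n)] with the stated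
    probability.

    For the deterministic part, write [A] and [A + E] in singular value form
    [U s V^T], [U' s' V'^T], and put [K = U'^T U], [H = V'^T V].  The matrices
    [U'^T E V] and [V'^T E^T U] have entries [s'_i H_ij - s_j K_ij] and
    [s'_i K_ij - s_j H_ij]; for [i > r >= j] this bounds [H_ij] and [K_ij] through
    the gap, which is Wedin's theorem, and the difference of the truncations is
    expressed by the same entries. *)

(** * Frobenius norm and operator norm bounds *)

(** The two summands of the sampling probability have separate tasks: the [l1norm] one bounds every
    rescaled error entry by 1, the Frobenius one bounds its variance by [q / d]. The walk length
    follows [q] because a new vertex gains a factor [d] and its new edge costs [q / d]: each vertex
    is worth [q], which is also its worth in a matrix of size about [k] when [k ~ q]. The moment
    bound then fails with probability at most [4 d / 16 ^ k], so the logarithm is needed only to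
    make [k] large, and the norm bound itself carries none. The comparison entries are asymmetric
    because a walk may use an edge an odd number of times: a random sign has vanishing third moment
    and could not dominate skewed error entries. In the deterministic part a large singular value
    must not multiply a small entry of [H] or [K]; the entrywise relations trade it for one of index
    beyond [r], which is how [sigma A r.+1] gets into the numerator. The claim concerns every best
    approximation, so the gap also has to make these unique. *)

Section SquaredNorm.
Variable R : realType.

Definition nf2 (m n : nat) (M : 'M[R]_(m, n)) : R := \sum_i \sum_j M i j ^+ 2.

Lemma nf2_ge0 m n (M : 'M[R]_(m, n)) : 0 <= nf2 M.
Proof. by rewrite sumr_ge0 // => i _; rewrite sumr_ge0 // => j _; exact: sqr_ge0. Qed.

Lemma sqr_frob m n (M : 'M[R]_(m, n)) : frob M ^+ 2 = nf2 M.
Proof. by rewrite sqr_sqrtr // nf2_ge0. Qed.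

Lemma frob_ge0 m n (M : 'M[R]_(m, n)) : 0 <= frob M.
Proof. exact: sqrtr_ge0. Qed.

Lemma frob_le m n (M : 'M[R]_(m, n)) c : 0 <= c -> (frob M <= c) = (nf2 M <= c ^+ 2).
Proof. by move=> c0; rewrite -sqr_frob ler_pXn2r // nnegrE ?frob_ge0. Qed.

Lemma nf2_eq0 m n (M : 'M[R]_(m, n)) : nf2 M = 0 -> M = 0.
Proof.
move=> /eqP; rewrite psumr_eq0 => [/allP h|i _]; last first.
  by rewrite sumr_ge0 // => j _; exact: sqr_ge0.
apply/matrixP => i j; rewrite mxE; have := h i (mem_index_enum i).
rewrite psumr_eq0 => [/allP /(_ j (mem_index_enum j))|k _]; last exact: sqr_ge0.
by rewrite sqrf_eq0 => /eqP.
Qed.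

Lemma nf2_mxtrace m n (M : 'M[R]_(m, n)) : nf2 M = \tr (M *m M^T).
Proof.
by apply: eq_bigr => i _; rewrite mxE; apply: eq_bigr => j _; rewrite mxE expr2.
Qed.

Lemma nf2_trmx m n (M : 'M[R]_(m, n)) : nf2 M^T = nf2 M.
Proof.
rewrite /nf2 exchange_big; apply: eq_bigr => i _.
by apply: eq_bigr => j _; rewrite mxE.
Qed.

Lemma nf20 m n : nf2 (0 : 'M[R]_(m, n)) = 0.
Proof.
by rewrite /nf2 big1 // => i _; rewrite big1 // => j _; rewrite mxE expr0n.
Qed.

Lemma nf2Z m n c (M : 'M[R]_(m, n)) : nf2 (c *: M) = c ^+ 2 * nf2 M.
Proof.
rewrite /nf2 mulr_sumr; apply: eq_bigr => i _; rewrite mulr_sumr.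
by apply: eq_bigr => j _; rewrite mxE exprMn.
Qed.

Lemma nf2N m n (M : 'M[R]_(m, n)) : nf2 (- M) = nf2 M.
Proof. by rewrite -scaleN1r nf2Z sqrrN expr1n mul1r. Qed.

Lemma nf2D m n (M N : 'M[R]_(m, n)) :
  nf2 (M + N) = nf2 M + \tr (M *m N^T) *+ 2 + nf2 N.
Proof.
rewrite !nf2_mxtrace linearD /= mulmxDl !mulmxDr !linearD /= -[\tr (N *m M^T)]mxtrace_tr.
by rewrite trmx_mul trmxK mulr2n !addrA.
Qed.

Lemma nf2_cV m (v : 'cV[R]_m) : nf2 v = \sum_i v i 0 ^+ 2.
Proof. by apply: eq_bigr => i _; rewrite big_ord1. Qed.

Lemma orthogonal_mx_tr n (U : 'M[R]_n) : orthogonal_mx U -> orthogonal_mx U^T.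
Proof. by move=> hU; rewrite /orthogonal_mx trmxK; exact: mulmx1C. Qed.

Lemma orthogonal_mxVl n (U : 'M[R]_n) : orthogonal_mx U -> U^T *m U = 1%:M.
Proof. exact: mulmx1C. Qed.

Lemma orthogonal_mxM n (U V : 'M[R]_n) :
  orthogonal_mx U -> orthogonal_mx V -> orthogonal_mx (U *m V).
Proof.
move=> hU hV; rewrite /orthogonal_mx trmx_mul mulmxA -(mulmxA U) hV mulmx1.
exact: hU.
Qed.

Lemma nf2_orthl m n (U : 'M[R]_m) (M : 'M[R]_(m, n)) :
  orthogonal_mx U -> nf2 (U *m M) = nf2 M.
Proof.
move=> hU; rewrite !nf2_mxtrace trmx_mul mulmxA mxtrace_mulC !mulmxA.
by rewrite orthogonal_mxVl // mul1mx.
Qed.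

Lemma nf2_orthr m n (V : 'M[R]_n) (M : 'M[R]_(m, n)) :
  orthogonal_mx V -> nf2 (M *m V) = nf2 M.
Proof.
move=> hV; rewrite -nf2_trmx trmx_mul nf2_orthl ?nf2_trmx //.
exact: orthogonal_mx_tr.
Qed.

(** Only upper bounds on the operator norm are ever needed, so no supremum is formed; squares avoid
    roots. *)
Definition opnorm_le m n (E : 'M[R]_(m, n)) (eta : R) : Prop :=
  forall x : 'cV[R]_n, nf2 (E *m x) <= eta ^+ 2 * nf2 x.

(** Triangle inequality without square roots: [0 <= nf2 (b *: M - a *: N)] bounds the cross term,
    with the weights that make the total exactly [(a + b) ^+ 2 * c]. Zero weights are treated first
    because the inequality is multiplied by [a * b]. *)
Lemma nf2D_le m n (M N : 'M[R]_(m, n)) a b c : 0 <= a -> 0 <= b ->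
  nf2 M <= a ^+ 2 * c -> nf2 N <= b ^+ 2 * c -> nf2 (M + N) <= (a + b) ^+ 2 * c.
Proof.
rewrite le_eqVlt => /predU1P[<-|a0] b0 hM hN.
  have /nf2_eq0 -> : nf2 M = 0.
    by apply/eqP; rewrite eq_le nf2_ge0 andbT; move: hM; rewrite expr0n mul0r.
  by rewrite !add0r.
move: b0; rewrite le_eqVlt => /predU1P[b0|b0].
  have /nf2_eq0 -> : nf2 N = 0.
    by apply/eqP; rewrite eq_le nf2_ge0 andbT; move: hN; rewrite -b0 expr0n mul0r.
  by rewrite -b0 !addr0.
have h := nf2_ge0 (b *: M - a *: N).
rewrite nf2D linearN /= mulmxN linearN /= nf2N !nf2Z in h.
rewrite linearZ /= -scalemxAr -scalemxAl !mxtraceZ in h.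
rewrite nf2D -(ler_pM2l (mulr_gt0 a0 b0)).
set t := \tr _ in h *; move: (nf2_ge0 M) (nf2_ge0 N) => M0 N0.
have h1 : b * (a + b) * nf2 M <= b * (a + b) * (a ^+ 2 * c).
  by rewrite ler_wpM2l // mulr_ge0 ?addr_ge0 // ltW.
have h2 : a * (a + b) * nf2 N <= a * (a + b) * (b ^+ 2 * c).
  by rewrite ler_wpM2l // mulr_ge0 ?addr_ge0 // ltW.
rewrite -subr_ge0 in h1; rewrite -subr_ge0 in h2; rewrite -subr_ge0.
have -> : a * b * ((a + b) ^+ 2 * c) - a * b * (nf2 M + t *+ 2 + nf2 N) =
  (b * (a + b) * (a ^+ 2 * c) - b * (a + b) * nf2 M) +
  (a * (a + b) * (b ^+ 2 * c) - a * (a + b) * nf2 N) +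
  (b ^+ 2 * nf2 M + - (a * (b * t)) *+ 2 + a ^+ 2 * nf2 N) by ring.
exact: addr_ge0 (addr_ge0 h1 h2) h.
Qed.

End SquaredNorm.

(** * Singular value decomposition *)

Section SphereMax.
Import classical_sets functions topology normedtype derive.
Import numFieldNormedType.Exports.
Variable R : realType.

Lemma continuous_nf2_mul m n (M : 'M[R]_(n.+1, m.+1)) :
  continuous (fun x : 'rV[R]_n.+1 => nf2 (x *m M)).
Proof.
have cs (T : topologicalType) (I : Type) (s : seq I) (F : I -> T -> R) :
    (forall i, continuous (F i)) -> continuous (fun x => \sum_(i <- s) F i x).
  move=> cF; elim: s => [|i s IHs] x.
    rewrite (_ : (fun _ => _) = cst 0); first exact: cst_continuous.
    by apply/funext => y; rewrite big_nil.
  rewrite (_ : (fun _ => _) = (fun y => F i y + \sum_(j <- s) F j y)).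
    exact: (@continuousD _ _ _ (F i) _ x (cF i x) (IHs x)).
  by apply/funext => y; rewrite big_cons.
apply: (cs) => i; apply: (cs) => j x.
have cl : {for x, continuous (fun y : 'rV[R]_n.+1 => (y *m M) i j)}.
  rewrite (_ : (fun _ => _) = (fun y : 'rV[R]_n.+1 => \sum_k y i k * M k j)).
    apply: (cs) => k y; apply: (@continuousM _ _ (fun y : 'rV[R]_n.+1 => y i k)).
      exact: coord_continuous.
    exact: cst_continuous.
  by apply/funext => y; rewrite mxE.
rewrite (_ : (fun _ => _) = (fun y => (y *m M) i j * (y *m M) i j)).
  exact: continuousM.
by apply/funext => y; rewrite expr2.
Qed.

(** Compactness of the unit sphere gives the maximiser, homogeneity extends the bound to all [x]. In
    the decomposition below, [v] becomes a top singular vector. *)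
Lemma sphere_max m n (M : 'M[R]_(n.+1, m.+1)) :
  exists2 v : 'rV[R]_n.+1, nf2 v = 1 &
    forall x : 'rV[R]_n.+1, nf2 (x *m M) <= nf2 (v *m M) * nf2 x.
Proof.
pose S := [set x : 'rV[R]_n.+1 | nf2 x = 1]%classic.
have S0 : (S !=set0)%classic.
  exists (delta_mx 0 0); rewrite /S /= /nf2 big_ord1 (bigD1 0) //= big1 => [|j j0].
    by rewrite mxE !eqxx expr1n addr0.
  by rewrite mxE (negbTE j0) andbF expr0n.
have cS : compact S.
  apply: bounded_closed_compact.
    exists 1; split; first by rewrite num_real.
    move=> M0 M1 x; rewrite /S /= => hx; rewrite [leLHS]mx_normrE.
    apply/bigmax_leP; split=> [|[i j] _ /=]; first by rewrite ltW // (lt_trans _ M1).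
    apply: le_trans (ltW M1); rewrite -(@ler_pXn2r _ 2) ?nnegrE // real_normK ?num_real //.
    rewrite expr1n -hx /nf2 (bigD1 i) //= (bigD1 j) //= -addrA lerDl addr_ge0 //.
      by apply: sumr_ge0 => k _; exact: sqr_ge0.
    by apply: sumr_ge0 => l _; apply: sumr_ge0 => k _; exact: sqr_ge0.
  have -> : S = ((fun x : 'rV[R]_n.+1 => nf2 (x *m 1%:M)) @^-1` [set 1])%classic.
    by apply/seteqP; split => x; rewrite /S /= mulmx1.
  apply: preimage_closed; last exact: closed_eq.
  by move=> x _; apply: continuous_nf2_mul.
have [] := EVT_max_rV (f := fun x => nf2 (x *m M)) S0 cS.
  by apply: continuous_subspaceT; exact: continuous_nf2_mul.
move=> v; rewrite inE /S /= => hv vmax; exists v => // x.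
have [/nf2_eq0 ->|x0] := eqVneq (nf2 x) 0; first by rewrite mul0mx !nf20 mulr0.
have sx : 0 < Num.sqrt (nf2 x) by rewrite sqrtr_gt0 lt_def x0 nf2_ge0.
have := vmax ((Num.sqrt (nf2 x))^-1 *: x); rewrite inE /S /=.
rewrite -scalemxAl !nf2Z exprVn sqr_sqrtr ?nf2_ge0 // => /(_ (mulVf x0)).
by rewrite mulrC ler_pdivrMr // lt_def x0 nf2_ge0.
Qed.

End SphereMax.

Section SVD.
Variable R : realType.

Lemma orthogonal_mx1 n : orthogonal_mx (1%:M : 'M[R]_n).
Proof. by rewrite /orthogonal_mx trmx1 mul1mx. Qed.

Lemma nf2_row1 n (v : 'rV[R]_n) : v *m v^T = (nf2 v)%:M.
Proof. by rewrite [LHS]mx11_scalar nf2_mxtrace /mxtrace big_ord1. Qed.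

(** First-order condition for the Rayleigh quotient, with a finite step instead of a derivative:
    moving [v] along the residual [g] would raise the quotient unless [g = 0]. *)
Lemma sphere_max_eigen m n (M : 'M[R]_(n.+1, m.+1)) (v : 'rV[R]_n.+1) :
  nf2 v = 1 -> (forall x : 'rV[R]_n.+1, nf2 (x *m M) <= nf2 (v *m M) * nf2 x) ->
  v *m M *m M^T = nf2 (v *m M) *: v.
Proof.
set l := nf2 (v *m M) => hv hmax; apply/eqP; rewrite -subr_eq0; apply/eqP.
set g := (X in X = 0); apply: nf2_eq0; apply/eqP; rewrite eq_le nf2_ge0 andbT leNgt.
apply/negP => g0; have l0 : 0 <= l by exact: nf2_ge0.
(* Any positive [t] with [t * l < 2] works. *)
pose t := (l + 1)^-1; have t0 : 0 < t by rewrite invr_gt0; lra.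
have := hmax (v + t *: g); rewrite mulmxDl !nf2D hv -/l -scalemxAl !nf2Z.
rewrite !linearZ /= trmx_mul mulmxA.
have -> : v *m M *m M^T = g + l *: v by rewrite subrK.
rewrite mulmxDl linearD /= -scalemxAl mxtraceZ -nf2_mxtrace.
set a := \tr _; set b := nf2 (g *m M); have b0 : 0 <= b by exact: nf2_ge0.
rewrite leNgt => /negP; apply; rewrite -subr_gt0.
have -> : l + (t * (nf2 g + l * a)) *+ 2 + t ^+ 2 * b -
   l * (1 + (t * a) *+ 2 + t ^+ 2 * nf2 g) =
   t ^+ 2 * b + t * nf2 g * (2 - t * l) by ring.
apply: ltr_wpDl; first by rewrite mulr_ge0 ?sqr_ge0.
apply: mulr_gt0; first by apply: mulr_gt0.
have : t * (l + 1) = 1 by rewrite mulVf //; apply: lt0r_neq0; lra.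
lra.
Qed.

Lemma reflection_orthogonal n (w : 'rV[R]_n) : nf2 w != 0 ->
  orthogonal_mx (1%:M - (2 / nf2 w) *: (w^T *m w)).
Proof.
set c := 2 / nf2 w => w0; set W := w^T *m w.
have WW : W *m W = nf2 w *: W.
  by rewrite /W mulmxA -(mulmxA w^T w) nf2_row1 mul_mx_scalar -scalemxAl.
have Ws : W^T = W by rewrite /W trmx_mul trmxK.
clearbody W.
have -> : orthogonal_mx (1%:M - c *: W) = ((1%:M - c *: W) *m (1%:M - c *: W) = 1%:M).
  rewrite /orthogonal_mx (_ : (1%:M - c *: W)^T = 1%:M - c *: W) //.
  apply/matrixP => i j; have /matrixP/(_ i j) := Ws; rewrite !mxE eq_sym => ->.
  by [].
rewrite mulmxBl mul1mx mulmxBr mulmx1 -scalemxAl -scalemxAr WW !scalerA.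
rewrite (_ : c * c * nf2 w = c + c); last by rewrite /c; field.
by rewrite scalerDl; apply/matrixP => i j; rewrite !mxE; ring.
Qed.

(** The reflection along [e - v] exchanges the unit vectors [e] and [v]; it degenerates when
    [e = v], where the identity serves. *)
Lemma householder n (v : 'rV[R]_n.+1) : nf2 v = 1 ->
  exists2 H : 'M[R]_n.+1, orthogonal_mx H & delta_mx 0 0 *m H = v.
Proof.
move=> hv; pose e : 'rV[R]_n.+1 := delta_mx 0 0.
have he : nf2 e = 1.
  rewrite /nf2 big_ord1 (bigD1 0) //= big1 => [|j j0].
    by rewrite mxE !eqxx expr1n addr0.
  by rewrite mxE (negbTE j0) andbF expr0n.
have [<-|ev] := eqVneq e v.
  by exists 1%:M; rewrite ?mulmx1 //; exact: orthogonal_mx1.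
pose w := e - v; have w0 : nf2 w != 0.
  by apply: contra_neq ev => /nf2_eq0 /eqP; rewrite subr_eq0 => /eqP.
pose c := 2 / nf2 w; pose H := 1%:M - c *: (w^T *m w).
exists H; first exact: reflection_orthogonal.
rewrite /H mulmxBr mulmx1 -scalemxAr mulmxA.
have ew : e *m w^T = (nf2 w / 2)%:M.
  rewrite [LHS]mx11_scalar; congr (_%:M).
  have -> : nf2 w = 1 - \tr (e *m v^T) *+ 2 + 1.
    by rewrite nf2D nf2N he hv linearN /= mulmxN linearN /= mulNrn.
  have -> : (e *m w^T) 0 0 = 1 - \tr (e *m v^T).
    rewrite linearB /= mulmxBr !mxE /mxtrace big_ord1 -he nf2_mxtrace /mxtrace big_ord1.
    by rewrite !mxE.
  by field.
rewrite -/e ew mul_scalar_mx scalerA (_ : c * _ = 1); last by rewrite /c; field.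
by rewrite scale1r /w opprB addrC subrK.
Qed.

(** Convertible to the middle factor in [is_svd]. *)
Definition sv_mx m n (s : nat -> R) : 'M[R]_(m, n) :=
  \matrix_(i < m, j < n) if (i : nat) == j then s i else 0.

Lemma sv_mx_block m n (s : nat -> R) (c : R) :
  sv_mx m.+1 n.+1 (fun k => if k is k'.+1 then s k' else c) =
  block_mx c%:M 0 0 (sv_mx m n s) :> 'M_(1 + m, 1 + n).
Proof.
apply/matrixP => i j; rewrite !mxE.
case: splitP => i' Hi; rewrite !mxE; case: splitP => j' Hj;
  rewrite !mxE Hi Hj ?(ord1 i') ?(ord1 j') //=.
Qed.

Lemma orthogonal_block1 n (U : 'M[R]_n) : orthogonal_mx U ->
  orthogonal_mx (block_mx 1%:M 0 0 U : 'M_(1 + n)).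
Proof.
move=> hU; rewrite /orthogonal_mx tr_block_mx !trmx0 trmx1 mulmx_block.
by rewrite !mulmx0 !mul0mx !mulmx1 !addr0 !add0r hU -scalar_mx_block.
Qed.

Lemma nf2_row_mx m n1 n2 (A : 'M[R]_(m, n1)) (B : 'M[R]_(m, n2)) :
  nf2 (row_mx A B) = nf2 A + nf2 B.
Proof. by rewrite !nf2_mxtrace tr_row_mx mul_row_col linearD. Qed.

(** Induction peels off the top singular pair: [v] maximises the quotient, [u] is its normalised
    image, and reflections taking the first basis vectors to [u] and [v] bring [M] to block diagonal
    form with corner [c]. *)
Lemma svd_exists m n (M : 'M[R]_(m, n)) : exists U V s, is_svd M U V s.
Proof.
elim: m n M => [|m IHm] [|n] M.
- exists 1%:M, 1%:M, (fun=> 0); split=> //; first by split; exact: orthogonal_mx1.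
  by apply/matrixP => -[].
- exists 1%:M, 1%:M, (fun=> 0); split=> //; first by split; exact: orthogonal_mx1.
  by apply/matrixP => -[].
- exists 1%:M, 1%:M, (fun=> 0); split=> //; first by split; exact: orthogonal_mx1.
  by apply/matrixP => i -[].
have [v hv vmax] := sphere_max M^T.
have vM := sphere_max_eigen hv vmax; rewrite trmxK in vM.
set l := nf2 (v *m M^T) in vmax vM; have l0 : 0 <= l by exact: nf2_ge0.
have [l00|lN0] := eqVneq l 0.
  have M0 : M = 0.
    apply: trmx_inj; rewrite trmx0; apply/row_matrixP => i.
    rewrite row0 rowE; apply: nf2_eq0; apply/eqP.
    by rewrite eq_le nf2_ge0 andbT (le_trans (vmax _)) // l00 mul0r.
  exists 1%:M, 1%:M, (fun=> 0); split=> //; first by split; exact: orthogonal_mx1.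
  by rewrite mul1mx trmx1 mulmx1 M0; apply/matrixP => i j; rewrite !mxE if_same.
pose c := Num.sqrt l; have c2 : c ^+ 2 = l by rewrite sqr_sqrtr.
have c0 : c != 0 by rewrite -(sqrf_eq0 c) c2.
pose u := c^-1 *: (v *m M^T).
have hu : nf2 u = 1 by rewrite /u nf2Z exprVn c2 mulVf.
have uM : u *m M = c *: v.
  by rewrite /u -scalemxAl vM scalerA -c2 expr2 mulrA mulVf // mul1r.
have vMt : v *m M^T = c *: u by rewrite /u scalerA divff // scale1r.
have [Hu oHu eHu] := householder hu; have [Hv oHv eHv] := householder hv.
pose N : 'M_(1 + m, 1 + n) := Hu *m M *m Hv^T.
have MN : M = Hu^T *m N *m Hv.
  rewrite /N !mulmxA (orthogonal_mxVl oHu) mul1mx -mulmxA (orthogonal_mxVl oHv).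
  by rewrite mulmx1.
(* This relation and the next say that the first row and the first column of [N] vanish off the
   corner. *)
have eN : delta_mx 0 0 *m N = c *: (delta_mx 0 0 : 'rV_(1 + n)).
  rewrite /N !mulmxA eHu uM -scalemxAl -eHv -mulmxA oHv mulmx1 //.
have eNt : delta_mx 0 0 *m N^T = c *: (delta_mx 0 0 : 'rV_(1 + m)).
  rewrite /N !trmx_mul trmxK !mulmxA eHv vMt -scalemxAl -eHu -mulmxA oHu mulmx1 //.
clearbody N.
have NB : N = block_mx c%:M 0 0 (drsubmx N).
  rewrite -[LHS]submxK; congr block_mx.
  - apply/matrixP => i j; rewrite !ord1 !mxE.
    have /rowP/(_ 0) := eN; rewrite -rowE !mxE !eqxx mulr1 => <-.
    by congr (fun_of_matrix N _ _); apply: val_inj.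
  - apply/matrixP => i j; rewrite !ord1 !mxE.
    have /rowP/(_ (rshift 1 j)) := eN; rewrite -rowE !mxE /= mulr0 => <-.
    by congr (fun_of_matrix N _ _); apply: val_inj.
  apply/matrixP => i j; rewrite !ord1 !mxE.
  have /rowP/(_ (rshift 1 i)) := eNt; rewrite -rowE !mxE /= mulr0 => <-.
  by congr (fun_of_matrix N _ _); apply: val_inj.
set M' := drsubmx N in NB; have [U' [V' [s [[oU oV] s0 smono smin M'E]]]] := IHm n M'.
exists (Hu^T *m (block_mx 1%:M 0 0 U' : 'M_(1 + m))).
exists (Hv^T *m (block_mx 1%:M 0 0 V' : 'M_(1 + n))).
exists (fun k => if k is k'.+1 then s k' else c); split.
- by split; apply: orthogonal_mxM;
    [exact: orthogonal_mx_tr|exact: orthogonal_block1|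
     exact: orthogonal_mx_tr|exact: orthogonal_block1].
- by case=> [|k]; [exact: sqrtr_ge0|exact: s0].
(* Ordering at the junction, [s 0 <= c]: the top singular vector of the remaining block, padded by
   zero and rotated back, is a competitor in the maximum defining [l = c ^+ 2]. *)
- case=> //; case: (posnP (minn m n)) => [mn0|mn0].
    by rewrite smin ?sqrtr_ge0 // mn0.
  have m0 : (0 < m)%N by rewrite (leq_trans mn0) ?geq_minl.
  have n0 : (0 < n)%N by rewrite (leq_trans mn0) ?geq_minr.
  rewrite -(@ler_pXn2r _ 2) ?nnegrE ?sqrtr_ge0 // c2.
  pose z : 'rV[R]_n := delta_mx 0 (Ordinal n0).
  have z1 : nf2 z = 1.
    rewrite /nf2 big_ord1 (bigD1 (Ordinal n0)) //= big1 => [|j j0].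
      by rewrite mxE !eqxx expr1n addr0.
    by rewrite mxE (negbTE j0) andbF expr0n.
  pose x : 'rV[R]_n.+1 := (row_mx 0 (z *m V'^T) : 'rV_(1 + n)) *m Hv.
  have x1 : nf2 x = 1.
    rewrite /x nf2_orthr // (@nf2_row_mx 1 1 n) nf20 add0r nf2_orthr //.
    exact: orthogonal_mx_tr.
  have := vmax x; rewrite x1 mulr1; apply: le_trans.
  have -> : nf2 (x *m M^T) = nf2 (z *m (sv_mx m n s)^T).
    rewrite /x MN !trmx_mul trmxK !mulmxA -(mulmxA _ Hv) oHv mulmx1 nf2_orthr //.
    rewrite NB (@tr_block_mx _ 1 m 1 n) !trmx0 (@mul_row_block _ 1 1 n 1 m).
    rewrite !mulmx0 !mul0mx !addr0 add0r (@nf2_row_mx 1 1 m) nf20 add0r.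
    rewrite M'E !trmx_mul trmxK !mulmxA -(mulmxA _ V'^T) (orthogonal_mxVl oV) mulmx1.
    by rewrite nf2_orthr //; exact: orthogonal_mx_tr.
  rewrite /nf2 big_ord1 (bigD1 (Ordinal m0)) //= -rowE !mxE /= lerDl.
  by apply: sumr_ge0 => j _; exact: sqr_ge0.
- by case=> [|k]; rewrite minnSS // ltnS; exact: smin.
set S := \matrix_(i, j) _; have -> : S = block_mx c%:M 0 0 (sv_mx m n s) :> 'M_(1 + m, 1 + n).
  exact: sv_mx_block.
rewrite trmx_mul trmxK (@tr_block_mx _ 1 n 1 n) !trmx0 trmx1.
have key : (block_mx 1%:M 0 0 U' : 'M_(1 + m)) *m block_mx c%:M 0 0 (sv_mx m n s) *m
    (block_mx 1%:M 0 0 V'^T : 'M_(1 + n)) = N.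
  rewrite !mulmx_block !mulmx0 !mul0mx !mulmx1 !mul1mx !addr0 !add0r.
  by rewrite mul0mx [RHS]NB M'E.
by rewrite [LHS]MN -key !mulmxA.
Qed.

End SVD.

(** * Weyl's inequality *)

Section Padding.
Variable R : realType.

(* Entry [(i, j)] of the matrix bordered by zeros; with it, rectangular products
   with [sv_mx] become entrywise scalings without side conditions. *)
Definition entry m n (M : 'M[R]_(m, n)) (i j : nat) : R :=
  if insub i is Some i' then if insub j is Some j' then M i' j' else 0 else 0.

Lemma entryE m n (M : 'M[R]_(m, n)) (i : 'I_m) (j : 'I_n) : entry M i j = M i j.
Proof. by rewrite /entry !valK. Qed.

Lemma entry_outl m n (M : 'M[R]_(m, n)) i j : (m <= i)%N -> entry M i j = 0.
Proof. by move=> mi; rewrite /entry insubF // ltnNge mi. Qed.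

Lemma entry_outr m n (M : 'M[R]_(m, n)) i j : (n <= j)%N -> entry M i j = 0.
Proof.
by move=> nj; rewrite /entry; case: insub => // i'; rewrite insubF // ltnNge nj.
Qed.

Lemma entry_inj m n (M N : 'M[R]_(m, n)) : (forall i j, entry M i j = entry N i j) -> M = N.
Proof. by move=> h; apply/matrixP => i j; rewrite -!entryE h. Qed.

Lemma entry_tr m n (M : 'M[R]_(m, n)) i j : entry M^T i j = entry M j i.
Proof.
have [mi|im] := leqP n i; first by rewrite entry_outl // entry_outr.
have [nj|jn] := leqP m j; first by rewrite entry_outr // entry_outl.
by rewrite (entryE M^T (Ordinal im) (Ordinal jn)) (entryE M (Ordinal jn) (Ordinal im)) mxE.
Qed.

Lemma entryD m n (M N : 'M[R]_(m, n)) i j : entry (M + N) i j = entry M i j + entry N i j.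
Proof.
rewrite /entry; case: insub => [i'|]; last by rewrite addr0.
by case: insub => [j'|]; rewrite ?addr0 // mxE.
Qed.

Lemma entryN m n (M : 'M[R]_(m, n)) i j : entry (- M) i j = - entry M i j.
Proof.
rewrite /entry; case: insub => [i'|]; last by rewrite oppr0.
by case: insub => [j'|]; rewrite ?oppr0 // mxE.
Qed.

Lemma sum_ord_pad (F : nat -> R) n d : (n <= d)%N -> (forall i, (n <= i)%N -> F i = 0) ->
  \sum_(i < n) F i = \sum_(0 <= i < d) F i.
Proof.
move=> nd F0; rewrite (big_cat_nat (leq0n n) nd) /= [X in _ + X]big_nat_cond.
rewrite [X in _ + X]big1 ?addr0 ?big_mkord // => i /andP[/andP[ni _] _].
exact: F0.
Qed.

Lemma nf2_entry m n (M : 'M[R]_(m, n)) d : (m <= d)%N -> (n <= d)%N ->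
  nf2 M = \sum_(0 <= i < d) \sum_(0 <= j < d) entry M i j ^+ 2.
Proof.
move=> md nd; rewrite -(@sum_ord_pad _ m) // => [|i mi].
  apply: eq_bigr => i _; rewrite -(@sum_ord_pad _ n) // => [|j nj].
    by apply: eq_bigr => j _; rewrite entryE.
  by rewrite entry_outr // expr0n.
by rewrite big1 // => j _; rewrite entry_outl // expr0n.
Qed.

Lemma entry_sv_mul m n p (s : nat -> R) (Y : 'M[R]_(n, p)) i j :
  (forall k, (minn m n <= k)%N -> s k = 0) ->
  entry (sv_mx m n s *m Y) i j = s i * entry Y i j.
Proof.
move=> s0; have [mi|im] := leqP m i.
  by rewrite entry_outl // s0 ?mul0r // geq_min mi.
have [pj|jp] := leqP p j; first by rewrite !entry_outr // mulr0.
rewrite (entryE (_ *m _) (Ordinal im) (Ordinal jp)) mxE.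
have [ni|ni] := leqP n i.
  rewrite s0 ?mul0r ?geq_min ?ni ?orbT // big1 // => k _.
  by rewrite mxE s0 ?if_same ?mul0r // geq_min ni orbT.
rewrite (entryE Y (Ordinal ni) (Ordinal jp)) (bigD1 (Ordinal ni)) //= mxE eqxx.
rewrite big1 ?addr0 // => k kn; rewrite mxE /=.
by case: eqVneq => [ik|]; rewrite ?mul0r //; case/eqP: kn; apply: val_inj.
Qed.

Lemma entry_mul_sv m n p (s : nat -> R) (Y : 'M[R]_(p, m)) i j :
  (forall k, (minn m n <= k)%N -> s k = 0) ->
  entry (Y *m sv_mx m n s) i j = entry Y i j * s j.
Proof.
move=> s0; rewrite -entry_tr trmx_mul.
have -> : (sv_mx m n s)^T = sv_mx n m s.
  by apply/matrixP => k l; rewrite !mxE eq_sym; case: eqP => // ->.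
by rewrite entry_sv_mul 1?minnC // entry_tr mulrC.
Qed.

Lemma sum_sqr_col_orthogonal n (W : 'M[R]_n) d j : orthogonal_mx W -> (n <= d)%N -> (j < n)%N ->
  \sum_(0 <= i < d) entry W i j ^+ 2 = 1.
Proof.
move=> /orthogonal_mxVl /matrixP h nd jn.
rewrite -(@sum_ord_pad _ n) // => [|i ni]; last by rewrite entry_outl // expr0n.
have := h (Ordinal jn) (Ordinal jn); rewrite !mxE eqxx mulr1n => <-.
apply: eq_bigr => i _; rewrite mxE -!entryE /= expr2 //.
Qed.

Lemma sum_sqr_row_orthogonal n (W : 'M[R]_n) d i : orthogonal_mx W -> (n <= d)%N -> (i < n)%N ->
  \sum_(0 <= j < d) entry W i j ^+ 2 = 1.
Proof.
move=> hW nd jn; rewrite -(sum_sqr_col_orthogonal (orthogonal_mx_tr hW) nd jn).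
by apply: eq_bigr => j _; rewrite entry_tr.
Qed.

Lemma svd_mono m n (M : 'M[R]_(m, n)) U V s : is_svd M U V s ->
  forall i j, (i <= j)%N -> s j <= s i.
Proof.
case=> _ _ smono _ _ i j; elim: j => [|j IHj]; first by rewrite leqn0 => /eqP ->.
rewrite leq_eqVlt => /predU1P[->//|]; rewrite ltnS => /IHj; exact: le_trans.
Qed.

Lemma svd_eq m n (M : 'M[R]_(m, n)) U V s : is_svd M U V s ->
  M = U *m sv_mx m n s *m V^T.
Proof. by case. Qed.

Lemma svd_nf2_mul m n (M : 'M[R]_(m, n)) U V s (x : 'cV[R]_n) d :
  is_svd M U V s -> (m <= d)%N -> (n <= d)%N -> (1 <= d)%N ->
  nf2 (M *m x) = \sum_(0 <= i < d) s i ^+ 2 * entry (V^T *m x) i 0 ^+ 2.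
Proof.
move=> h md nd d1; have [[oU oV] _ _ smin _] := h.
rewrite (svd_eq h) -!mulmxA nf2_orthl // (nf2_entry _ md d1).
apply: eq_bigr => i _; rewrite -(@sum_ord_pad _ 1) // => [|j j1].
  by rewrite big_ord1 entry_sv_mul // exprMn.
by rewrite entry_outr // expr0n.
Qed.

Lemma cV_nf2_entry n (x : 'cV[R]_n) d : (n <= d)%N ->
  nf2 x = \sum_(0 <= i < d) entry x i 0 ^+ 2.
Proof.
move=> nd; rewrite nf2_cV -(@sum_ord_pad _ n) // => [|i ni].
  by apply: eq_bigr => i _; rewrite -entryE.
by rewrite entry_outl // expr0n.
Qed.

(** Dimension count: [k] linear conditions on [k + 1] free coordinates. [W] is transposed because
    [kermx] is a left kernel. *)
Lemma exists_small_kernel n (Z : 'M[R]_n) k : (k < n)%N ->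
  exists y : 'cV[R]_n, [/\ y != 0, forall i, (k < i)%N -> entry y i 0 = 0 &
    forall j, (j < k)%N -> entry (Z *m y) j 0 = 0].
Proof.
move=> kn; pose w := fun i : 'I_k.+1 => widen_ord kn i.
pose W : 'M[R]_(k.+1, k) := \matrix_(i, j) entry Z j i.
have : kermx W != 0.
  by rewrite -mxrank_eq0 mxrank_ker -lt0n subn_gt0 ltnS rank_leq_col.
rewrite -nz_row_eq0; have := nz_row_sub (kermx W); move: (nz_row _) => v.
move=> /sub_kermxP vW v0.
exists (\col_(i < n) entry v 0 i); split.
- apply: contra v0 => /eqP/colP y0; apply/eqP/rowP => i.
  by have := y0 (w i); rewrite !mxE -entryE.
- move=> i ki; have [ni|ni] := leqP n i; first by rewrite entry_outl.
  by rewrite (entryE _ (Ordinal ni) 0) mxE entry_outr.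
move=> j jk; have jn : (j < n)%N by exact: (ltn_trans jk kn).
rewrite (entryE _ (Ordinal jn) 0) mxE.
transitivity ((v *m W) 0 (Ordinal jk)); last by rewrite vW mxE.
rewrite [RHS]mxE; transitivity (\sum_(i < n) entry Z j i * entry v 0 i).
  by apply: eq_bigr => i _; rewrite -entryE mxE.
rewrite (@sum_ord_pad (fun i => entry Z j i * entry v 0 i) n n) // => [|i ni]; last first.
  by rewrite entry_outr // mul0r.
rewrite -(@sum_ord_pad _ k.+1) // => [|i ni]; last by rewrite [entry v _ _]entry_outr // mulr0.
by apply: eq_bigr => i _; rewrite mxE mulrC -(entryE v 0).
Qed.

(** Courant-Fischer argument: some non-zero [x] lies in the span of the first [k + 1] right singular
    vectors of [B] and is orthogonal to the first [k] of [A], so [B] stretches it by at least [s' k]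
    and [A] by at most [s k]. The reverse inequality comes from exchanging [A] and [B]. *)
Lemma weyl_singular_values m n (A B : 'M[R]_(m, n)) U V s U' V' s' eta k :
  is_svd A U V s -> is_svd B U' V' s' -> 0 <= eta -> opnorm_le (B - A) eta ->
  s' k <= s k + eta.
Proof.
move=> hA hB eta0 hE.
have [[oU oV] s0 _ _ _] := hA; have [[oU' oV'] s'0 _ smin' _] := hB.
have [kmin|] := leqP (minn m n) k; first by rewrite smin' // addr_ge0.
rewrite leq_min => /andP[km kn].
have [y [y0 ysupp yker]] := exists_small_kernel (V^T *m V') kn.
pose x := V' *m y; pose d := maxn m n.
have md : (m <= d)%N by rewrite leq_maxl.
have nd : (n <= d)%N by rewrite leq_maxr.
have d1 : (1 <= d)%N by apply: leq_trans nd; apply: leq_ltn_trans kn.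
have xy : nf2 x = nf2 y by rewrite nf2_orthl.
have Vx : V'^T *m x = y by rewrite mulmxA (orthogonal_mxVl oV') mul1mx.
have x0 : 0 < nf2 x.
  by rewrite xy lt_def nf2_ge0 andbT; apply: contra_neq y0 => /nf2_eq0.
have hAx : nf2 (A *m x) <= s k ^+ 2 * nf2 x.
  rewrite (svd_nf2_mul x hA md nd d1) -(nf2_orthl x (orthogonal_mx_tr oV)).
  rewrite (cV_nf2_entry _ nd) mulr_sumr; apply: ler_sum => i _.
  have [ik|ki] := ltnP i k.
    by rewrite /x mulmxA yker // expr0n !mulr0.
  by rewrite ler_wpM2r ?sqr_ge0 // ler_pXn2r ?nnegrE // (svd_mono hA).
have hBx : s' k ^+ 2 * nf2 x <= nf2 (B *m x).
  rewrite (svd_nf2_mul x hB md nd d1) Vx xy.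
  rewrite (cV_nf2_entry _ nd) mulr_sumr; apply: ler_sum => i _.
  have [ik|ki] := ltnP k i; first by rewrite ysupp // expr0n !mulr0.
  by rewrite ler_wpM2r ?sqr_ge0 // ler_pXn2r ?nnegrE // (svd_mono hB).
have := nf2D_le (s0 k) eta0 hAx (hE x).
rewrite -mulmxDl addrC subrK => /(le_trans hBx).
by rewrite ler_pM2r // ler_pXn2r ?nnegrE ?addr_ge0.
Qed.

End Padding.

(** * Best approximation of given rank *)

Section EckartYoung.
Variable R : realType.

Definition sv_trunc (r : nat) (s : nat -> R) (k : nat) : R := if (k < r)%N then s k else 0.

Lemma sv_trunc_eq0 r s p : (forall k, (p <= k)%N -> s k = 0) ->
  forall k, (p <= k)%N -> sv_trunc r s k = 0.
Proof. by move=> s0 k /s0 sk; rewrite /sv_trunc sk if_same. Qed.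

Lemma rank_sv_mx_trunc m n r (s : nat -> R) : (\rank (sv_mx m n (sv_trunc r s)) <= r)%N.
Proof.
have -> : sv_mx m n (sv_trunc r s) =
    (pid_mx r : 'M_(m, r)) *m \matrix_(i < r, j < n) (if (i : nat) == j then s i else 0).
  apply/matrixP => i j; rewrite !mxE; case: (ltnP i r) => ir.
    rewrite (bigD1 (Ordinal ir)) //= !mxE eqxx ir mul1r big1 ?addr0 ?/sv_trunc ?ir // => k ki.
    rewrite !mxE; case: eqP => [ik|]; rewrite ?mul0r //; case/eqP: ki; exact: val_inj.
  rewrite /sv_trunc ltnNge ir /= if_same big1 // => k _.
  by rewrite !mxE; case: eqP => [ik|]; rewrite ?mul0r // ik ltnNge -ik ir mul0r.
by rewrite (leq_trans (mxrankM_maxl _ _)) // rank_leq_col.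
Qed.

(** If [s r] were positive, the leading diagonal block of size [r + 1] would be invertible and would
    factor through [B]. *)
Lemma svd_rank_eq0 m n (B : 'M[R]_(m, n)) U V s r :
  is_svd B U V s -> (\rank B <= r)%N -> forall k, (r <= k)%N -> s k = 0.
Proof.
move=> hB rB k rk; have [[oU oV] s0 _ smin _] := hB.
suff sr : s r = 0 by apply/eqP; rewrite eq_le s0 andbT -sr (svd_mono hB).
apply/eqP; apply: contraT => srN0.
have : (r < minn m n)%N by rewrite ltnNge; apply: contra srN0 => /smin ->.
rewrite leq_min => /andP[rm rn].
have srgt0 i : (i <= r)%N -> 0 < s i.
  by move=> ir; rewrite (lt_le_trans _ (svd_mono hB ir)) // lt_def srN0 s0.
pose D : 'M[R]_r.+1 := diag_mx (\row_i s i).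
have DE : D = (pid_mx r.+1 : 'M_(r.+1, m)) *m sv_mx m n s *m (pid_mx r.+1 : 'M_(n, r.+1)).
  apply/matrixP => i j; pose i' := widen_ord rm i; pose j' := widen_ord rn j.
  rewrite -mulmxA !mxE (bigD1 i') //= big1 ?addr0 => [|k0 ki]; last first.
    by rewrite !mxE; case: eqP => [ik|]; rewrite ?mul0r //; case/eqP: ki; exact: val_inj.
  rewrite !mxE /= eqxx ltn_ord mul1r (bigD1 j') //= big1 ?addr0 => [|k0 kj]; last first.
    rewrite !mxE; case: (eqVneq (k0 : nat) j) => [kj'|]; rewrite ?mulr0 //.
    by case/eqP: kj; exact: val_inj.
  by rewrite !mxE /= eqxx ltn_ord mulr1 -val_eqE /=; case: eqP.
have : \rank D = r.+1.
  apply: mxrank_unit; rewrite unitmxE det_diag unitfE; apply/prodf_neq0 => i _.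
  by rewrite mxE gt_eqF // srgt0 // -ltnS.
have svE : sv_mx m n s = U^T *m B *m V.
  rewrite (svd_eq hB) !mulmxA (orthogonal_mxVl oU) mul1mx -mulmxA.
  by rewrite (orthogonal_mxVl oV) mulmx1.
rewrite DE svE => rk'.
have : (r.+1 <= \rank B)%N.
  rewrite -rk' (leq_trans (mxrankM_maxl _ _)) // (leq_trans (mxrankM_maxr _ _)) //.
  by rewrite (leq_trans (mxrankM_maxl _ _)) // mxrankM_maxr.
by rewrite ltnNge rB.
Qed.

(** Uniqueness in the Eckart-Young theorem: under a gap, optimality leaves no choice, so an
    arbitrary best approximation can be replaced by the truncation. *)
Lemma best_rank_approx_svd m n (M B : 'M[R]_(m, n)) U V s r :
  is_svd M U V s -> best_rank_approx r M B -> (0 < r)%N -> (r <= minn m n)%N ->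
  s r < s r.-1 -> B = U *m sv_mx m n (sv_trunc r s) *m V^T.
Proof.
move=> hM [rB Bmin] r0 rmin gap; have [[oU oV] s0 _ smin _] := hM.
have [rm rn] : (r <= m)%N /\ (r <= n)%N by apply/andP; rewrite -leq_min.
have [UB [VB [sB hB]]] := svd_exists B.
have [[oUB oVB] _ _ sBmin _] := hB.
have sB0 := svd_rank_eq0 hB rB.
pose d := maxn m n.
have md : (m <= d)%N by rewrite leq_maxl.
have nd : (n <= d)%N by rewrite leq_maxr.
have rd : (r <= d)%N by exact: leq_trans nd.
(* In the left basis [UB] of [B] and the right basis [V] of [M], [B] becomes [X], whose rows from
   [r] on vanish by the rank bound, and [M] becomes [W *m sv_mx m n s]. *)
pose W := UB^T *m U; pose X := sv_mx m n sB *m (VB^T *m V).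
have oW : orthogonal_mx W by apply: orthogonal_mxM => //; exact: orthogonal_mx_tr.
have UW : UB *m W = U by rewrite /W mulmxA oUB mul1mx.
have Xr i j : (r <= i)%N -> entry X i j = 0.
  by move=> ri; rewrite entry_sv_mul // sB0 // mul0r.
have tr0 := sv_trunc_eq0 r smin.
have BE : B = UB *m X *m V^T.
  by rewrite (svd_eq hB) /X -!mulmxA oV mulmx1.
clearbody X W.
have nf2MB : nf2 (M - B) = nf2 (W *m sv_mx m n s - X).
  rewrite (svd_eq hM) BE -{1}UW -mulmxBl nf2_orthr; last exact: orthogonal_mx_tr.
  by rewrite -(mulmxA UB) -mulmxBr nf2_orthl.
have nf2MT : nf2 (M - U *m sv_mx m n (sv_trunc r s) *m V^T) = \sum_(r <= j < d) s j ^+ 2.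
  rewrite (svd_eq hM) -mulmxBl nf2_orthr; last exact: orthogonal_mx_tr.
  rewrite -mulmxBr (nf2_entry _ md nd) exchange_big (big_cat_nat (leq0n r) rd) /=.
  have cE j i : (j < d)%N -> entry (U *m (sv_mx m n s - sv_mx m n (sv_trunc r s))) i j =
      entry U i j * (s j - sv_trunc r s j).
    by move=> jd; rewrite mulmxBr entryD entryN !entry_mul_sv // -mulrBr.
  rewrite big_nat big1 ?add0r => [|j /andP[_ jr]]; last first.
    rewrite big1 // => i _; rewrite cE; last exact: leq_trans rd.
    by rewrite /sv_trunc jr subrr mulr0 expr0n.
  apply: eq_big_nat => j /andP[rj jd].
  have [mj|jm] := leqP m j.
    rewrite smin ?geq_min ?mj // expr0n big1 // => i _.
    by rewrite cE // entry_outr // mul0r expr0n.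
  rewrite -[RHS]mul1r -(sum_sqr_col_orthogonal oU md jm) mulr_suml.
  by apply: eq_bigr => i _; rewrite cE // /sv_trunc ltnNge rj subr0 exprMn.
have opt : nf2 (W *m sv_mx m n s - X) <= \sum_(r <= j < d) s j ^+ 2.
  rewrite -nf2MB -nf2MT -!sqr_frob ler_pXn2r ?nnegrE ?frob_ge0 //; apply: Bmin.
  rewrite (leq_trans (mxrankM_maxl _ _)) // (leq_trans (mxrankM_maxr _ _)) //.
  exact: rank_sv_mx_trunc.
(* Squared norm of the [j]-th left singular vector of [M] projected on ([t j]) and
   off ([w j]) the column space of [B]. *)
pose t j := \sum_(0 <= i < r) entry W i j ^+ 2.
pose w j := \sum_(r <= i < d) entry W i j ^+ 2.
pose Z := \sum_(0 <= i < r) \sum_(0 <= j < d) entry (W *m sv_mx m n s - X) i j ^+ 2.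
pose tau := \sum_(r <= j < d) t j.
have t_ge0 j : 0 <= t j by apply: sumr_ge0 => i _; exact: sqr_ge0.
have w_ge0 j : 0 <= w j by apply: sumr_ge0 => i _; exact: sqr_ge0.
have Z_ge0 : 0 <= Z by apply: sumr_ge0 => i _; apply: sumr_ge0 => j _; exact: sqr_ge0.
have tau_ge0 : 0 <= tau by exact: sumr_ge0.
have tw j : (j < m)%N -> t j + w j = 1.
  by move=> jm; rewrite -(sum_sqr_col_orthogonal oW md jm) (big_cat_nat (leq0n r) rd).
(* The two off-diagonal blocks of an orthogonal matrix have equal mass: the first [r] rows and the
   first [r] columns both have total mass [r]. *)
have sumw : \sum_(0 <= j < r) w j = tau.
  have : \sum_(0 <= j < d) t j = \sum_(0 <= j < r) (t j + w j).
    rewrite exchange_big /= big_nat [RHS]big_nat; apply: eq_bigr => i /andP[_ ir].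
    have im := leq_trans ir rm.
    by rewrite (sum_sqr_row_orthogonal oW md im) tw.
  rewrite (big_cat_nat (leq0n r) rd) /= big_split /= => /addrI; exact: esym.
have splitE : nf2 (W *m sv_mx m n s - X) = Z + \sum_(0 <= j < d) s j ^+ 2 * w j.
  rewrite (nf2_entry _ md nd) (big_cat_nat (leq0n r) rd) /=; congr (_ + _).
  rewrite exchange_big /=; apply: eq_bigr => j _; rewrite mulr_sumr.
  rewrite big_nat [RHS]big_nat; apply: eq_bigr => i /andP[ri _].
  by rewrite entryD entryN Xr // subr0 entry_mul_sv // exprMn mulrC.
(* By optimality, [Z] plus the sum of [s j ^+ 2 * w j] over [j < r] is at most the sum of
   [s j ^+ 2 * (1 - w j)] over [j >= r]. The weights sum to [tau] on the left and to at most [tau]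
   on the right where [s j] can be non-zero, while the squares are at least [s r.-1 ^+ 2] on the
   left and at most [s r ^+ 2] on the right. *)
have main : (s r.-1 ^+ 2 - s r ^+ 2) * tau + Z <= 0.
  have h1 : s r.-1 ^+ 2 * tau <= \sum_(0 <= j < r) s j ^+ 2 * w j.
    rewrite -sumw mulr_sumr big_nat [leRHS]big_nat; apply: ler_sum => j /andP[_ jr].
    rewrite ler_wpM2r // ler_pXn2r ?nnegrE // (svd_mono hM) //; lia.
  have h2 : \sum_(r <= j < d) s j ^+ 2 - \sum_(r <= j < d) s j ^+ 2 * w j <= s r ^+ 2 * tau.
    rewrite -sumrB mulr_sumr big_nat [leRHS]big_nat; apply: ler_sum => j /andP[rj _].
    have [mj|jm] := leqP m j.
      by rewrite smin ?geq_min ?mj // expr0n mul0r subr0 mulr_ge0 ?sqr_ge0.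
    rewrite -{1}[s j ^+ 2]mulr1 -(tw j jm) -mulrBr addrK.
    by rewrite ler_wpM2r // ler_pXn2r ?nnegrE // (svd_mono hM).
  move: opt; rewrite splitE (big_cat_nat (leq0n r) rd) /=; move: h1 h2.
  by lra.
have gap2 : 0 < s r.-1 ^+ 2 - s r ^+ 2 by rewrite subr_gt0 ltr_pXn2r ?nnegrE.
have gtau_ge0 := mulr_ge0 (ltW gap2) tau_ge0.
have Z0 : Z = 0 by lra.
have tau0 : tau = 0.
  have : (s r.-1 ^+ 2 - s r ^+ 2) * tau = 0 by lra.
  by move/eqP; rewrite mulf_eq0 gt_eqF //= => /eqP.
have sum0 (a b : nat) (F : nat -> R) : (forall i, 0 <= F i) ->
    \sum_(a <= i < b) F i = 0 -> forall i, (a <= i < b)%N -> F i = 0.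
  move=> F0 /eqP; rewrite psumr_eq0 => [/allP h i iab|i _]; last exact: F0.
  by apply/eqP; apply: h; rewrite mem_index_iota.
have W1 i j : (i < r)%N -> (r <= j < d)%N -> entry W i j = 0.
  move=> ir rj; have := sum0 _ _ _ t_ge0 tau0 j rj.
  move/(sum0 _ _ _ (fun k => sqr_ge0 _))/(_ i ir)/eqP; rewrite sqrf_eq0; exact: eqP.
have W2 i j : (r <= i < d)%N -> (j < r)%N -> entry W i j = 0.
  move=> ri jr; have := sum0 _ _ _ w_ge0 (etrans sumw tau0) j jr.
  move/(sum0 _ _ _ (fun k => sqr_ge0 _))/(_ i ri)/eqP; rewrite sqrf_eq0; exact: eqP.
suff XE : X = W *m sv_mx m n (sv_trunc r s) by rewrite BE XE mulmxA UW.
apply: entry_inj => i j; rewrite entry_mul_sv //.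
have [di|id'] := leqP d i.
  by rewrite !entry_outl ?mul0r //; apply: leq_trans di.
have [dj|jd] := leqP d j.
  by rewrite !entry_outr ?mul0r //; apply: leq_trans dj.
have [ri|ir] := leqP r i.
  rewrite Xr // /sv_trunc; case: ltnP => jr; last by rewrite mulr0.
  by rewrite W2 ?mul0r // ri.
have : entry (W *m sv_mx m n s - X) i j = 0.
  apply/eqP; rewrite -sqrf_eq0; apply/eqP.
  have h := sum0 _ _ _ (fun k => sumr_ge0 _ (fun l _ => sqr_ge0 _)) Z0 i ir.
  exact: (sum0 _ _ _ (fun k => sqr_ge0 _) h j jd).
rewrite entryD entryN entry_mul_sv // => /eqP; rewrite subr_eq0 => /eqP <-.
rewrite /sv_trunc; case: ltnP => jr //.
by rewrite W1 ?mul0r // jr.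
Qed.

End EckartYoung.

(** * Perturbation of the truncated singular value decomposition *)

Section Perturbation.
Variable R : realType.

Lemma svd_tr m n (A : 'M[R]_(m, n)) U V s : is_svd A U V s -> is_svd A^T V U s.
Proof.
case=> -[oU oV] s0 smono smin ->; split=> //; first by rewrite minnC.
rewrite !trmx_mul trmxK !mulmxA; congr (_ *m _ *m _).
by apply/matrixP => k l; rewrite !mxE eq_sym; case: eqP => // ->.
Qed.

Lemma svd_opnorm_le m n (A : 'M[R]_(m, n)) U V s eta :
  is_svd A U V s -> s 0%N <= eta -> opnorm_le A eta.
Proof.
move=> hA s0eta x; have [[oU oV] s0 _ _ _] := hA.
pose d := (maxn m n).+1.
have md : (m <= d)%N by rewrite leqW // leq_maxl.
have nd : (n <= d)%N by rewrite leqW // leq_maxr.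
rewrite (svd_nf2_mul x hA md nd) // -(nf2_orthl x (orthogonal_mx_tr oV)).
rewrite (cV_nf2_entry _ nd) mulr_sumr; apply: ler_sum => i _.
rewrite ler_wpM2r ?sqr_ge0 // ler_pXn2r ?nnegrE // ?(le_trans _ s0eta) //.
exact: svd_mono hA _ _ (leq0n i).
Qed.

Lemma opnorm_le_col m n (E : 'M[R]_(m, n)) eta P Q d j :
  opnorm_le E eta -> orthogonal_mx P -> orthogonal_mx Q -> (m <= d)%N ->
  \sum_(0 <= i < d) entry (P *m E *m Q) i j ^+ 2 <= eta ^+ 2.
Proof.
move=> hE oP oQ md; have [nj|jn] := leqP n j.
  by rewrite big1 ?sqr_ge0 // => i _; rewrite entry_outr // expr0n.
pose j' := Ordinal jn.
have -> : \sum_(0 <= i < d) entry (P *m E *m Q) i j ^+ 2 = nf2 (P *m E *m col j' Q).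
  rewrite (cV_nf2_entry _ md); apply: eq_bigr => i _; congr (_ ^+ 2).
  have [mi|im] := leqP m i; first by rewrite !entry_outl.
  rewrite (entryE _ (Ordinal im) j') (entryE _ (Ordinal im) 0) !mxE.
  by apply: eq_bigr => k _; rewrite [col _ _ _ _]mxE.
rewrite -mulmxA nf2_orthl // (le_trans (hE _)) // -[leRHS]mulr1 ler_wpM2l ?sqr_ge0 //.
rewrite (cV_nf2_entry _ (leqnn n)) -(sum_sqr_col_orthogonal oQ (leqnn n) jn).
rewrite le_eqVlt; apply/orP; left; apply/eqP/eq_big_nat => i /andP[_ ni].
by rewrite (entryE _ (Ordinal ni) 0) mxE -entryE.
Qed.

(** Indices start at 0, so [s r] is the singular value just below the gap; no larger one occurs in
    the bound. *)
Lemma svd_trunc_perturbation m n (A B : 'M[R]_(m, n)) U V s U' V' s' eta delta r :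
  is_svd A U V s -> is_svd B U' V' s' -> 0 <= eta ->
  opnorm_le (B - A) eta -> opnorm_le (B - A)^T eta ->
  (0 < r)%N -> (r <= minn m n)%N ->
  delta = s r.-1 - s r -> 0 < delta -> eta <= delta / 4 ->
  nf2 (U' *m sv_mx m n (sv_trunc r s') *m V'^T - U *m sv_mx m n (sv_trunc r s) *m V^T) <=
  16 * r%:R * eta ^+ 2 * (1 + (s r / delta) ^+ 2).
Proof.
move=> hA hB eta0 hE hEt r0 rmin deltaE delta0 eta_le.
have [[oU oV] s0 _ smin _] := hA; have [[oU' oV'] s'0 _ smin' _] := hB.
have [rm rn] : (r <= m)%N /\ (r <= n)%N by apply/andP; rewrite -leq_min.
pose d := maxn m n.
have md : (m <= d)%N by rewrite leq_maxl.
have nd : (n <= d)%N by rewrite leq_maxr.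
have rd : (r <= d)%N by exact: leq_trans nd.
have [oUt oVt] := (orthogonal_mx_tr oU, orthogonal_mx_tr oV).
have [oU't oV't] := (orthogonal_mx_tr oU', orthogonal_mx_tr oV').
pose K := entry (U'^T *m U); pose H := entry (V'^T *m V).
pose F := entry (U'^T *m (B - A) *m V); pose F' := entry (V'^T *m (B - A)^T *m U).
have oK : orthogonal_mx (U'^T *m U) by exact: orthogonal_mxM.
have FE i j : F i j = s' i * H i j - s j * K i j.
  have -> : F = entry (sv_mx m n s' *m (V'^T *m V) - U'^T *m U *m sv_mx m n s).
    rewrite /F (svd_eq hA) (svd_eq hB); congr entry.
    rewrite mulmxBr mulmxBl !mulmxA (orthogonal_mxVl oU') mul1mx.
    by rewrite -(mulmxA _ V^T) (orthogonal_mxVl oV) mulmx1.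
  by rewrite entryD entryN entry_sv_mul // entry_mul_sv // [s j * _]mulrC.
have F'E i j : F' i j = s' i * K i j - s j * H i j.
  have [smin2 smin2'] : (forall k, (minn n m <= k)%N -> s k = 0) /\
      (forall k, (minn n m <= k)%N -> s' k = 0) by rewrite minnC.
  have -> : F' = entry (sv_mx n m s' *m (U'^T *m U) - V'^T *m V *m sv_mx n m s).
    rewrite /F' linearB /= (svd_eq (svd_tr hA)) (svd_eq (svd_tr hB)); congr entry.
    rewrite mulmxBr mulmxBl !mulmxA (orthogonal_mxVl oV') mul1mx.
    by rewrite -(mulmxA _ U^T) (orthogonal_mxVl oU) mulmx1.
  by rewrite entryD entryN entry_sv_mul // entry_mul_sv // [s j * _]mulrC.
have [tr0 tr0'] := (sv_trunc_eq0 r smin, sv_trunc_eq0 r smin').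
have -> : nf2 (U' *m sv_mx m n (sv_trunc r s') *m V'^T - U *m sv_mx m n (sv_trunc r s) *m V^T) =
    \sum_(0 <= i < d) \sum_(0 <= j < d) (sv_trunc r s' i * H i j - sv_trunc r s j * K i j) ^+ 2.
  (* In the left basis of [B] and the right basis of [A] the difference has the same form as [F],
     with truncated singular values. *)
  rewrite -(nf2_orthl _ oU't) -(nf2_orthr _ oV) (nf2_entry _ md nd).
  apply: eq_bigr => i _; apply: eq_bigr => j _; congr (_ ^+ 2).
  rewrite mulmxBr mulmxBl !mulmxA (orthogonal_mxVl oU') mul1mx -!(mulmxA _ _ V).
  rewrite (orthogonal_mxVl oV) mulmx1 entryD entryN entry_sv_mul // entry_mul_sv //.
  by rewrite [sv_trunc r s j * _]mulrC.
have Fcol j : \sum_(0 <= i < d) F i j ^+ 2 <= eta ^+ 2 by exact: opnorm_le_col.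
have F'col j : \sum_(0 <= i < d) F' i j ^+ 2 <= eta ^+ 2 by exact: opnorm_le_col.
have Frow i : \sum_(0 <= j < d) F i j ^+ 2 <= eta ^+ 2.
  rewrite (eq_bigr (fun j => entry (V^T *m (B - A)^T *m U') j i ^+ 2)) => [|j _].
    exact: opnorm_le_col.
  by rewrite /F -entry_tr !trmx_mul trmxK mulmxA.
clearbody F F'.
(* The gap between the kept values of [A] and the discarded values of [B]; Weyl and
   [eta <= delta / 4] keep three quarters of [delta]. *)
pose g := s r.-1 - s' r.
have s'r : s' r <= s r + eta by exact: weyl_singular_values hA hB eta0 hE.
have gge : delta * (3 / 4) <= g by rewrite /g; lra.
have g0 : 0 < g by lra.
pose S (G : nat -> nat -> R) := \sum_(r <= i < d) \sum_(0 <= j < r) G i j ^+ 2.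
have SHK : S H + S K <= 2 * r%:R * eta ^+ 2 / g ^+ 2.
  rewrite ler_pdivlMr ?exprn_gt0 // mulrC.
  apply: (@le_trans _ _ (S F + S F')).
    rewrite /S -!big_split /= mulr_sumr [leLHS]big_nat [leRHS]big_nat /=.
    apply: ler_sum => i /andP[ri _].
    rewrite -!big_split /= mulr_sumr [leLHS]big_nat [leRHS]big_nat /=.
    apply: ler_sum => j jr; rewrite FE F'E.
    have sj : s r.-1 <= s j by apply: (svd_mono hA); lia.
    have s'i : s' i <= s' r by exact: (svd_mono hB).
    have gij : g ^+ 2 <= (s j - s' i) ^+ 2.
      by rewrite ler_pXn2r ?nnegrE ?(ltW g0) // /g; lra.
    apply: (@le_trans _ _ ((s j - s' i) ^+ 2 * (H i j ^+ 2 + K i j ^+ 2))).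
      by rewrite ler_wpM2r // addr_ge0 ?sqr_ge0.
    (* Adding the squares of [F i j] and [F' i j] leaves [(s j - s' i) ^+ 2 * (H i j ^+ 2 + K i j ^+
       2)] plus twice this non-negative term. *)
    have h1 : 0 <= s j * s' i * (H i j - K i j) ^+ 2.
      by apply: mulr_ge0 (mulr_ge0 (s0 j) (s'0 i)) (sqr_ge0 _).
    rewrite -subr_ge0 (_ : _ - _ = 2 * (s j * s' i * (H i j - K i j) ^+ 2)); last by ring.
    by rewrite mulr_ge0.
  have Sle (G : nat -> nat -> R) : (forall j, \sum_(0 <= i < d) G i j ^+ 2 <= eta ^+ 2) ->
      S G <= r%:R * eta ^+ 2.
    move=> hG; rewrite /S exchange_big /=.
    apply: (@le_trans _ _ (\sum_(0 <= j < r) eta ^+ 2)).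
      apply: ler_sum => j _; apply: le_trans (hG j); rewrite (big_cat_nat (leq0n r) rd) /=.
      by rewrite lerDr sumr_ge0 // => i _; exact: sqr_ge0.
    by rewrite big_const_nat subn0 iter_addr_0 mulr_natl.
  by have := Sle _ Fcol; have := Sle _ F'col; lra.
(* Equal mass of the off-diagonal blocks of an orthogonal matrix: the bound on the lower left block
   of [K] passes to the upper right one. *)
have SKt : \sum_(0 <= i < r) \sum_(r <= j < d) K i j ^+ 2 = S K.
  have e1 : \sum_(0 <= i < r) \sum_(0 <= j < d) K i j ^+ 2 =
            \sum_(0 <= j < r) \sum_(0 <= i < d) K i j ^+ 2.
    rewrite big_nat [RHS]big_nat; apply: eq_bigr => i /andP[_ ir].
    have im := leq_trans ir rm.
    by rewrite /K (sum_sqr_row_orthogonal oK md im) (sum_sqr_col_orthogonal oK md im).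
  have e2 : \sum_(0 <= i < r) \sum_(0 <= j < d) K i j ^+ 2 =
      \sum_(0 <= i < r) \sum_(0 <= j < r) K i j ^+ 2 +
      \sum_(0 <= i < r) \sum_(r <= j < d) K i j ^+ 2.
    rewrite -big_split; apply: eq_bigr => i _; exact: (big_cat_nat (leq0n r) rd).
  have e3 : \sum_(0 <= j < r) \sum_(0 <= i < d) K i j ^+ 2 =
      \sum_(0 <= i < r) \sum_(0 <= j < r) K i j ^+ 2 + S K.
    rewrite /S [X in _ = X + _]exchange_big [X in _ = _ + X]exchange_big -big_split.
    by apply: eq_bigr => i _; exact: (big_cat_nat (leq0n r) rd).
  by apply: (addrI (\sum_(0 <= i < r) \sum_(0 <= j < r) K i j ^+ 2)); rewrite -e2 e1 e3.
pose c := (s r + eta) ^+ 2.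
have cH : s' r ^+ 2 <= c by rewrite ler_pXn2r ?nnegrE ?addr_ge0.
have cK : s r ^+ 2 <= c by rewrite ler_pXn2r ?nnegrE ?addr_ge0 // lerDl.
(* Upper left entries are those of [F]. Upper right ones are [s' i * H i j = F i j + s j * K i j]
   with [j >= r], and lower left ones are [- s j * K i j = F i j - s' i * H i j] with [i >= r], so
   only singular values bounded through [c] multiply [H] and [K]. Summing [F] over [r] rows and over
   [r] columns gives a factor [r] rather than [d]. *)
have trunc_diff_le : \sum_(0 <= i < d) \sum_(0 <= j < d)
    (sv_trunc r s' i * H i j - sv_trunc r s j * K i j) ^+ 2 <=
    4 * r%:R * eta ^+ 2 + 2 * c * (S H + S K).
  rewrite (big_cat_nat (leq0n r) rd) /=.
  have top : \sum_(0 <= i < r) \sum_(0 <= j < d)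
      (sv_trunc r s' i * H i j - sv_trunc r s j * K i j) ^+ 2 <=
      2 * r%:R * eta ^+ 2 + 2 * c * S K.
    rewrite -SKt.
    apply: (@le_trans _ _ (\sum_(0 <= i < r) (2 * eta ^+ 2 +
       2 * c * \sum_(r <= j < d) K i j ^+ 2))).
      rewrite big_nat [leRHS]big_nat; apply: ler_sum => i /andP[_ ir].
      apply: (@le_trans _ _ (2 * (\sum_(0 <= j < d) F i j ^+ 2) +
         2 * c * \sum_(r <= j < d) K i j ^+ 2)); last by rewrite lerD2r ler_wpM2l.
      rewrite !(big_cat_nat (leq0n r) rd) /= mulrDr -addrA; apply: lerD.
        rewrite mulr_sumr big_nat [leRHS]big_nat; apply: ler_sum => j /andP[_ jr].
        by rewrite /sv_trunc ir jr -FE ler_peMl ?sqr_ge0 // ler1n.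
      rewrite !mulr_sumr -big_split big_nat [leRHS]big_nat /=.
      apply: ler_sum => j /andP[rj _]; rewrite /sv_trunc ir ltnNge rj /= mul0r subr0.
      have -> : s' i * H i j = F i j + s j * K i j by rewrite FE subrK.
      apply: (@le_trans _ _ (2 * F i j ^+ 2 + 2 * (s j * K i j) ^+ 2)).
        by rewrite -subr_ge0 (_ : _ - _ = (F i j - s j * K i j) ^+ 2) ?sqr_ge0 //; ring.
      rewrite lerD2l -mulrA ler_wpM2l // exprMn ler_wpM2r ?sqr_ge0 //.
      by apply: le_trans cK; rewrite ler_pXn2r ?nnegrE // (svd_mono hA).
    rewrite big_split /= -[X in _ + X <= _]mulr_sumr lerD2r big_const_nat subn0 iter_addr_0.
    by rewrite -[leLHS]mulr_natl mulrA [_ * 2]mulrC.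
  have bot : \sum_(r <= i < d) \sum_(0 <= j < d)
      (sv_trunc r s' i * H i j - sv_trunc r s j * K i j) ^+ 2 <=
      2 * r%:R * eta ^+ 2 + 2 * c * S H.
    apply: (@le_trans _ _ (\sum_(r <= i < d) \sum_(0 <= j < r)
       (2 * F i j ^+ 2 + 2 * c * H i j ^+ 2))).
      rewrite big_nat [leRHS]big_nat; apply: ler_sum => i /andP[ri _].
      rewrite (big_cat_nat (leq0n r) rd) /= [X in _ + X]big_nat [X in _ + X]big1 ?addr0; last first.
        move=> j /andP[rj _]; rewrite /sv_trunc !ltnNge ri rj /= !mul0r subr0 expr0n //.
      rewrite big_nat [leRHS]big_nat; apply: ler_sum => j /andP[_ jr].
      rewrite /sv_trunc ltnNge ri jr /= mul0r sub0r sqrrN.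
      have -> : s j * K i j = s' i * H i j - F i j by rewrite FE subKr.
      apply: (@le_trans _ _ (2 * F i j ^+ 2 + 2 * (s' i * H i j) ^+ 2)).
        by rewrite -subr_ge0 (_ : _ - _ = (F i j + s' i * H i j) ^+ 2) ?sqr_ge0 //; ring.
      rewrite lerD2l -mulrA ler_wpM2l // exprMn ler_wpM2r ?sqr_ge0 //.
      by apply: le_trans cH; rewrite ler_pXn2r ?nnegrE // (svd_mono hB).
    rewrite /S exchange_big /= [X in _ <= _ + _ * X]exchange_big /= mulr_sumr.
    apply: (@le_trans _ _ (\sum_(0 <= j < r) (2 * eta ^+ 2 +
       2 * c * \sum_(r <= i < d) H i j ^+ 2))).
      apply: ler_sum => j _; rewrite big_split /= -!mulr_sumr lerD2r ler_wpM2l //.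
      apply: le_trans (Fcol j); rewrite (big_cat_nat (leq0n r) rd) /=.
      by rewrite lerDr sumr_ge0 // => i _; exact: sqr_ge0.
    rewrite big_split /= lerD2r big_const_nat subn0 iter_addr_0.
    by rewrite -[leLHS]mulr_natl mulrA [_ * 2]mulrC.
  by move: top bot; lra.
apply: (le_trans trunc_diff_le).
pose q := r%:R * eta ^+ 2; have q0 : 0 <= q by rewrite mulr_ge0 ?sqr_ge0.
pose x := s r / delta; have x0 : 0 <= x by rewrite divr_ge0 // ltW.
have srE : s r = x * delta by rewrite /x divfK // gt_eqF.
have c0 : 0 <= c by exact: sqr_ge0.
have h1 : 2 * c * (S H + S K) <= 2 * c * (2 * q / g ^+ 2).
  by apply: ler_wpM2l; [exact: mulr_ge0|rewrite /q mulrA].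
(* From [c <= delta ^+ 2 * (2 * x ^+ 2 + 1 / 8)] and [g ^+ 2 >= 9 / 16 * delta ^+ 2]. *)
have h2 : c / g ^+ 2 <= 4 * x ^+ 2 + 1 / 4.
  rewrite ler_pdivrMr ?exprn_gt0 //.
  apply: (@le_trans _ _ ((4 * x ^+ 2 + 1 / 4) * (delta * (3 / 4)) ^+ 2)); last first.
    apply: ler_wpM2l; first by have := sqr_ge0 x; lra.
    by rewrite ler_pXn2r ?nnegrE //; lra.
  apply: (@le_trans _ _ (delta ^+ 2 * (2 * x ^+ 2 + 1 / 8))).
    rewrite /c srE.
    have : eta ^+ 2 <= delta ^+ 2 / 16.
      apply: (@le_trans _ _ ((delta / 4) ^+ 2)).
        by rewrite ler_pXn2r ?nnegrE // divr_ge0 // ltW.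
      by rewrite le_eqVlt; apply/orP; left; apply/eqP; field.
    have := sqr_ge0 (x * delta - eta); nra.
  have := mulr_ge0 (sqr_ge0 delta) (sqr_ge0 x); have := sqr_ge0 delta; nra.
have h3 : 4 * q * (c / g ^+ 2) <= 4 * q * (4 * x ^+ 2 + 1 / 4).
  by rewrite ler_wpM2l // mulr_ge0.
have -> : 4 * r%:R * eta ^+ 2 = 4 * q by rewrite /q mulrA.
have -> : 16 * r%:R * eta ^+ 2 * (1 + x ^+ 2) = 16 * q + 16 * q * x ^+ 2.
  by rewrite /q; ring.
have e5 : 4 * q * (4 * x ^+ 2 + 1 / 4) = 16 * q * x ^+ 2 + q by field.
have e4 : 2 * c * (2 * q / g ^+ 2) = 4 * q * (c / g ^+ 2) by field; rewrite gt_eqF.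
by move: h1 h3; rewrite e4 e5; lra.
Qed.

End Perturbation.

(** * Closed walks *)

Section WalkSum.
Variable R : realType.

(* The trace of [(X X^T)^k], expanded over closed walks of length [2k] in the
   complete bipartite graph on rows and columns. *)
Definition walk_sum k m n (X : 'M[R]_(m, n)) : R :=
  \sum_(f : {ffun 'I_k -> 'I_m}) \sum_(g : {ffun 'I_k -> 'I_n})
    \prod_t (X (f t) (g t) * X (f (ordS t)) (g t)).

Lemma cyclic_const k (T : Type) (l : 'I_k.+1 -> T) :
  (forall t, l t = l (ord_pred t)) -> forall t, l t = l ord0.
Proof.
move=> h [j jk]; elim: j jk => [|j IHj] jk; first by congr l; apply: val_inj.
rewrite h -(IHj (ltnW jk)); congr l; apply: val_inj => /=.
by rewrite modnDr modn_small // ltnW.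
Qed.

Lemma svd_gram m n (X : 'M[R]_(m, n)) U V s a b : is_svd X U V s ->
  (X *m X^T) a b = \sum_l U a l * (s l ^+ 2 * U b l).
Proof.
move=> hX; have [[oU oV] _ _ smin _] := hX.
have -> : X *m X^T = U *m sv_mx m n s *m (U *m sv_mx m n s)^T.
  rewrite {1 2}(svd_eq hX) [in LHS]trmx_mul trmxK mulmxA.
  by rewrite -(mulmxA _ V^T) (orthogonal_mxVl oV) mulmx1.
rewrite mxE.
transitivity (\sum_(j < n) entry U a j * entry U b j * s j ^+ 2).
  apply: eq_bigr => j _; rewrite [X in _ * X]mxE -!entryE !entry_mul_sv //; ring.
pose d := maxn m n.
rewrite (@sum_ord_pad _ (fun j => entry U a j * entry U b j * s j ^+ 2) n d) ?leq_maxr //.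
  rewrite -(@sum_ord_pad _ _ m) ?leq_maxl // => [|j mj].
    by apply: eq_bigr => l _; rewrite !entryE; ring.
  by rewrite entry_outr // !mul0r.
by move=> j nj; rewrite smin ?expr0n ?mulr0 // geq_min nj orbT.
Qed.

(** Each Gram entry is expanded in the basis [U] with its own label [l t]. Summing over the rows [f]
    uses orthogonality of the columns of [U] and forces neighbouring labels to agree, so one label
    survives around the cycle. *)
Lemma walk_sum_svd k m n (X : 'M[R]_(m, n)) U V s : is_svd X U V s ->
  walk_sum k.+1 X = \sum_(i < m) s i ^+ (2 * k.+1).
Proof.
move=> hX; have [[oU _] _ _ _ _] := hX.
transitivity (\sum_(f : {ffun 'I_k.+1 -> 'I_m}) \prod_t (X *m X^T) (f t) (f (ordS t))).
  apply: eq_bigr => f _.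
  rewrite -(bigA_distr_bigA (fun t j => X (f t) j * X (f (ordS t)) j)) /=.
  apply: eq_bigr => t _.
  by rewrite mxE; apply: eq_bigr => j _; rewrite mxE.
transitivity (\sum_(l : {ffun 'I_k.+1 -> 'I_m}) \sum_(f : {ffun 'I_k.+1 -> 'I_m})
   (\prod_t s (l t) ^+ 2) * \prod_t (U (f t) (l t) * U (f t) (l (ord_pred t)))).
  rewrite exchange_big; apply: eq_bigr => f _ /=.
  under eq_bigr do rewrite (svd_gram _ _ hX).
  rewrite bigA_distr_bigA /=; apply: eq_bigr => l _.
  under eq_bigr do rewrite mulrCA.
  rewrite !big_split /=; congr (_ * (_ * _)).
  rewrite (reindex_inj (h := @ord_pred k.+1)) /=; last exact: (can_inj (@ord_predK _)).
  by apply: eq_bigr => t _; rewrite ord_predK.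
transitivity (\sum_(l : {ffun 'I_k.+1 -> 'I_m}) \sum_(i < m)
   if l == [ffun=> i] then s i ^+ (2 * k.+1) else 0).
  apply: eq_bigr => l _; rewrite -mulr_sumr.
  rewrite -(bigA_distr_bigA (fun t a => U a (l t) * U a (l (ord_pred t)))) /=.
  have -> : \prod_t \sum_a U a (l t) * U a (l (ord_pred t)) =
      \prod_t ((l t == l (ord_pred t))%:R : R).
    apply: eq_bigr => t _; have /matrixP/(_ (l t) (l (ord_pred t))) := orthogonal_mxVl oU.
    by rewrite !mxE => <-; apply: eq_bigr => a _; rewrite mxE.
  have [/forallP h|] := boolP [forall t, l t == l (ord_pred t)].
    have lc := cyclic_const (fun t => eqP (h t)).
    rewrite [X in _ * X]big1 => [|t _]; last by rewrite (h t).
    rewrite mulr1 -big_mkcond /= (big_pred1 (l ord0)) => [|i /=].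
      under eq_bigr do rewrite lc.
      by rewrite prodr_const card_ord exprM.
    apply/eqP/eqP => [->|->]; first by rewrite ffunE.
    by apply/ffunP => t; rewrite ffunE lc.
  rewrite negb_forall => /existsP[t lt].
  rewrite [X in _ * X](bigD1 t) //= (negbTE lt) mul0r mulr0 big1 // => i _.
  by have [lE|//] := eqVneq l [ffun=> i]; rewrite lE !ffunE eqxx in lt.
rewrite exchange_big; apply: eq_bigr => i _.
by rewrite -big_mkcond /= big_pred1_eq.
Qed.

Lemma walk_sum_ge m n k (X : 'M[R]_(m, n)) U V s : is_svd X U V s ->
  s 0%N ^+ (2 * k.+1) <= walk_sum k.+1 X.
Proof.
move=> hX; rewrite (walk_sum_svd k hX); have [_ s0 _ smin _] := hX.
have pos i : 0 <= s i ^+ (2 * k.+1) by rewrite exprn_ge0.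
case: (posnP m) => [m0|m0].
  by rewrite smin ?m0 ?min0n // expr0n /= sumr_ge0.
by rewrite (bigD1 (Ordinal m0)) //= lerDl sumr_ge0.
Qed.

Lemma walk_sum_ge0 m n k (X : 'M[R]_(m, n)) : 0 <= walk_sum k.+1 X.
Proof.
have [U [V [s hX]]] := svd_exists X; apply: le_trans (walk_sum_ge k hX).
by rewrite exprn_ge0 //; case: hX.
Qed.

Lemma walk_sum_le m n k (X : 'M[R]_(m, n)) U V s : is_svd X U V s ->
  walk_sum k.+1 X <= m%:R * s 0%N ^+ (2 * k.+1).
Proof.
move=> hX; rewrite (walk_sum_svd k hX); have [_ s0 _ _ _] := hX.
apply: (@le_trans _ _ (\sum_(i < m) s 0%N ^+ (2 * k.+1))).
  by apply: ler_sum => i _; rewrite ler_pXn2r ?nnegrE // (svd_mono hX).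
by rewrite sumr_const card_ord mulr_natl.
Qed.

End WalkSum.

(** * Moment comparison *)

Section Expectation.
Variable R : realType.

Definition expect (I : finType) (p : I -> R) (F : {ffun I -> bool} -> R) : R :=
  \sum_(w : {ffun I -> bool}) (\prod_i (if w i then p i else 1 - p i)) * F w.

Lemma expect_prod (I : finType) (p : I -> R) (x : I -> bool -> R) :
  expect p (fun w => \prod_i x i (w i)) = \prod_i (p i * x i true + (1 - p i) * x i false).
Proof.
rewrite /expect.
transitivity (\prod_i \sum_(b : bool) (if b then p i else 1 - p i) * x i b).
  rewrite (bigA_distr_bigA (fun i (b : bool) => (if b then p i else 1 - p i) * x i b)).
  by apply: eq_bigr => w _; rewrite big_split.
by apply: eq_bigr => i _; rewrite big_bool.
Qed.

Lemma expect_sum (I : finType) (p : I -> R) (J : finType) (P : pred J) F :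
  expect p (fun w => \sum_(j | P j) F j w) = \sum_(j | P j) expect p (F j).
Proof.
rewrite /expect exchange_big; apply: eq_bigr => w _; exact: mulr_sumr.
Qed.

Lemma expectZ (I : finType) (p : I -> R) c F :
  expect p (fun w => c * F w) = c * expect p F.
Proof. by rewrite /expect mulr_sumr; apply: eq_bigr => w _; rewrite mulrCA. Qed.

Lemma expect1 (I : finType) (p : I -> R) : expect p (fun=> 1) = 1.
Proof.
transitivity (expect p (fun=> \prod_(i : I) 1)).
  by congr expect; apply/funext => w; rewrite big1.
by rewrite (expect_prod p (fun _ _ => 1)) big1 // => i _; rewrite !mulr1 addrC subrK.
Qed.

Lemma expect_le (I : finType) (p : I -> R) F G : (forall i, 0 <= p i <= 1) ->
  (forall w, F w <= G w) -> expect p F <= expect p G.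
Proof.
move=> p01 FG; apply: ler_sum => w _; rewrite ler_wpM2l // prodr_ge0 // => i _.
by have /andP[? ?] := p01 i; case: (w i); rewrite ?subr_ge0.
Qed.

Definition moment (I : Type) (p : I -> R) (x : I -> bool -> R) (i : I) (a : nat) : R :=
  p i * x i true ^+ a + (1 - p i) * x i false ^+ a.

Definition rand_mx m n (x : 'I_m * 'I_n -> bool -> R) (w : {ffun 'I_m * 'I_n -> bool}) :
  'M[R]_(m, n) := \matrix_(i, j) x (i, j) (w (i, j)).

(** For the closed walk [f 0, g 0, f 1, g 1, ...], the step [(t, false)] is the edge into the column
    [g t] and [(t, true)] the edge leaving it for the next row. *)
Definition walk_step (T1 T2 : Type) k (f : 'I_k -> T1) (g : 'I_k -> T2) (s : 'I_k * bool) :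
    T1 * T2 :=
  (f (if s.2 then ordS s.1 else s.1), g s.1).

Definition edge_mult m n k (f : 'I_k -> 'I_m) (g : 'I_k -> 'I_n) (e : 'I_m * 'I_n) : nat :=
  #|[pred s | walk_step f g s == e]|.

(** Collecting the steps by edge turns each walk into a product over independent entries. *)
Lemma expect_walk_sum k m n (p : 'I_m * 'I_n -> R) x :
  expect p (fun w => walk_sum k (rand_mx x w)) =
  \sum_(f : {ffun 'I_k -> 'I_m}) \sum_(g : {ffun 'I_k -> 'I_n})
    \prod_e moment p x e (edge_mult f g e).
Proof.
rewrite expect_sum; apply: eq_bigr => f _; rewrite expect_sum; apply: eq_bigr => g _.
rewrite -(expect_prod p (fun e b => x e b ^+ edge_mult f g e)); congr expect; apply/funext => w.
transitivity (\prod_(s : 'I_k * bool) x (walk_step f g s) (w (walk_step f g s))).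
  rewrite -(pair_bigA _ (fun t b => x (walk_step f g (t, b)) (w (walk_step f g (t, b))))) /=.
  by apply: eq_bigr => t _; rewrite big_bool !mxE mulrC.
rewrite (partition_big (walk_step f g) predT) //=; apply: eq_bigr => e _.
under eq_bigr => s /eqP -> do [].
by rewrite prodr_const.
Qed.

(** Phrased through coincidences of steps rather than multiplicities, so that it visibly depends
    only on the kernels of [f] and [g]. *)
Definition twice_covered (T1 T2 : eqType) k (f : 'I_k -> T1) (g : 'I_k -> T2) : bool :=
  [forall s, [exists s', (s' != s) && (walk_step f g s' == walk_step f g s)]].

Lemma twice_covered_mult m n k (f : 'I_k -> 'I_m) (g : 'I_k -> 'I_n) e :
  twice_covered f g -> edge_mult f g e = 0%N \/ (2 <= edge_mult f g e)%N.
Proof.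
move=> /forallP h; case: (posnP (edge_mult f g e)) => [|/card_gt0P[s]]; first by left.
rewrite inE => /eqP se; right.
have /existsP[s' /andP[ss' /eqP s'e]] := h s.
apply/card_gt1P; exists s, s'; rewrite !inE se s'e se !eqxx; split=> //.
by rewrite eq_sym.
Qed.

Lemma not_twice_covered_mult m n k (f : 'I_k -> 'I_m) (g : 'I_k -> 'I_n) :
  ~~ twice_covered f g -> exists e, edge_mult f g e = 1%N.
Proof.
rewrite negb_forall => /existsP[s]; rewrite negb_exists => /forallP h.
exists (walk_step f g s); rewrite /edge_mult -(card1 s); apply: eq_card => s'.
rewrite !inE; have := h s'; rewrite negb_and negbK.
by case: (eqVneq s' s) => [->|_ /= /negbTE]; rewrite ?eqxx.
Qed.

(* The kernel of [f], encoded as the map to the first index with the same value. *)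
Definition first_occ k (T : eqType) (f : 'I_k -> T) : {ffun 'I_k -> 'I_k} :=
  [ffun t => arg_min t (fun t' => f t' == f t) (@nat_of_ord k)].

Lemma first_occP k (T : eqType) (f : 'I_k -> T) t :
  f (first_occ f t) = f t /\ forall t', f t' = f t -> (first_occ f t <= t')%N.
Proof.
rewrite ffunE; case: arg_minnP => [//|i /eqP fi h]; split=> // t' /eqP; exact: h.
Qed.

Lemma first_occ_eq k (T : eqType) (f : 'I_k -> T) t t' :
  (first_occ f t == first_occ f t') = (f t == f t').
Proof.
have [ft fle] := first_occP f t; have [ft' fle'] := first_occP f t'.
apply/eqP/eqP => [e|e]; first by rewrite -ft -ft' e.
apply: val_inj; apply/eqP; rewrite eqn_leq fle ?fle' //; first by rewrite ft.
by rewrite ft'.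
Qed.

Lemma first_occ_ext k (T T' : eqType) (f : 'I_k -> T) (h : 'I_k -> T') :
  (forall t t', (f t == f t') = (h t == h t')) -> first_occ f = first_occ h.
Proof.
move=> fh; apply/ffunP => t; apply: val_inj; apply/eqP; rewrite eqn_leq.
have [/eqP ft fle] := first_occP f t; have [/eqP ht hle] := first_occP h t.
by rewrite fle ?hle //; apply/eqP; rewrite ?fh // -fh.
Qed.

Lemma first_occK k (T : eqType) (f : 'I_k -> T) : first_occ (first_occ f) = first_occ f.
Proof. by apply: first_occ_ext => t t'; exact: first_occ_eq. Qed.

(** The number of distinct values, each counted at its first occurrence. *)
Definition nvals k (T : eqType) (f : 'I_k -> T) : nat := #|[pred t | first_occ f t == t]|.

Lemma nvals_first_occ k (T : eqType) (f : 'I_k -> T) : nvals (first_occ f) = nvals f.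
Proof. by rewrite /nvals first_occK. Qed.

Lemma twice_covered_first_occ k (T1 T2 : eqType) (f : 'I_k -> T1) (g : 'I_k -> T2) :
  twice_covered (first_occ f) (first_occ g) = twice_covered f g.
Proof.
apply: eq_forallb => s; apply: eq_existsb => s'; congr (_ && _).
by rewrite /walk_step !xpair_eqE !first_occ_eq.
Qed.

Lemma nvals_gt0 k (T : eqType) (f : 'I_k.+1 -> T) : (0 < nvals f)%N.
Proof.
apply/card_gt0P; exists ord0; rewrite inE; apply/eqP/val_inj/eqP.
by have [_ /(_ ord0 erefl)] := first_occP f ord0; rewrite leqn0.
Qed.

Lemma nvals_le k (T : eqType) (f : 'I_k -> T) : (nvals f <= k)%N.
Proof. by rewrite -[X in (_ <= X)%N]card_ord max_card. Qed.

(* Connectedness: every vertex but the first is discovered through a new edge. *)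
Lemma nvals_le_edges k (T1 T2 : finType) (f : 'I_k.+1 -> T1) (g : 'I_k.+1 -> T2) :
  (nvals f + nvals g <= #|[set walk_step f g s | s : 'I_k.+1 * bool]|.+1)%N.
Proof.
pose F0 := [set t | (first_occ f t == t) && (t != ord0)].
pose G0 := [set t | first_occ g t == t].
(* A new row is entered from the preceding column, a new column from the row with the same index;
   the starting row [ord0] has no discovering edge and is left out of [F0]. *)
pose phi t := walk_step f g (ord_pred t, true).
pose psi t := walk_step f g (t, false).
have phiE t : phi t = (f t, g (ord_pred t)) by rewrite /phi /walk_step /= ord_predK.
have f_inj t t' : first_occ f t == t -> first_occ f t' == t' -> f t = f t' -> t = t'.
  by move=> /eqP {2}<- /eqP {2}<- /eqP; rewrite -first_occ_eq => /eqP.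
have g_inj t t' : first_occ g t == t -> first_occ g t' == t' -> g t = g t' -> t = t'.
  by move=> /eqP {2}<- /eqP {2}<- /eqP; rewrite -first_occ_eq => /eqP.
have nf : nvals f = #|F0|.+1.
  have -> : nvals f = #|[set t | first_occ f t == t]| by rewrite cardsE.
  rewrite (cardsD1 ord0) inE.
  have -> : first_occ f ord0 == ord0.
    apply/eqP/val_inj/eqP.
    by have [_ /(_ ord0 erefl)] := first_occP f ord0; rewrite leqn0.
  by rewrite add1n; congr _.+1; apply: eq_card => t; rewrite !inE andbC.
have ng : nvals g = #|G0| by rewrite cardsE.
rewrite nf ng addSn ltnS.
have c1 : #|phi @: F0| = #|F0|.
  apply: card_in_imset => t t'; rewrite !inE !phiE => /andP[ht _] /andP[ht' _] [+ _].
  exact: f_inj.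
have c2 : #|psi @: G0| = #|G0|.
  by apply: card_in_imset => t t'; rewrite !inE => ht ht' [_]; exact: g_inj.
(* If [phi t = psi t'], then [t <= t'] because [t] is the first visit of its row, and [t'] is at
   most the predecessor of [t] because [t'] is the first visit of its column. *)
have dis : [disjoint phi @: F0 & psi @: G0].
  apply/pred0P => e /=; apply/negbTE/negP => /andP[/imsetP[t] tF -> /imsetP[t' t'G]].
  move: tF t'G; rewrite !inE phiE => /andP[/eqP ft t0] /eqP gt' [fe ge].
  have [_ /(_ t' (esym fe))] := first_occP f t; rewrite ft => tt'.
  have [_ /(_ (ord_pred t) ge)] := first_occP g t'; rewrite gt' => t't.
  have : (ord_pred t < t)%N.
    case: t t0 {ft fe ge tt' t't} => -[|j] jk t0 /=; first by case/eqP: t0; apply: val_inj.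
    by rewrite modnDr modn_small // ltnW.
  by rewrite ltnNge (leq_trans tt' t't).
rewrite -c1 -c2 -cardsUI; have := dis; rewrite -setI_eq0 => /eqP ->.
rewrite cards0 addn0; apply: subset_leq_card; apply/subsetP => e; rewrite inE.
by case/orP => /imsetP[t _ ->]; exact: imset_f.
Qed.

(** An edge used once kills the term by centring; otherwise every distinct edge costs [theta], and
    connectedness gives at least [nvals f + nvals g - 1] of them. *)
Lemma walk_moment_le k m n (p : 'I_m * 'I_n -> R) x theta
    (f : {ffun 'I_k.+1 -> 'I_m}) (g : {ffun 'I_k.+1 -> 'I_n}) :
  0 <= theta <= 1 -> (forall e, moment p x e 1 = 0) ->
  (forall e a, (2 <= a)%N -> `|moment p x e a| <= theta) ->
  \prod_e moment p x e (edge_mult f g e) <=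
  (if twice_covered f g then theta ^+ (nvals f + nvals g).-1 else 0).
Proof.
move=> /andP[th0 th1] m1 m2; case: ifPn => [ev|/not_twice_covered_mult[e me]]; last first.
  by rewrite (bigD1 e) //= me m1 mul0r.
set E := [set walk_step f g s | s : 'I_k.+1 * bool].
apply: (@le_trans _ _ (\prod_e (if e \in E then theta else 1))).
  rewrite (le_trans (ler_norm _)) // normr_prod; apply: ler_prod => e _.
  rewrite normr_ge0 /=; case: ifPn => eE.
    apply: m2; case: (twice_covered_mult e ev) => // /eqP.
    by rewrite eqn0Ngt => /card_gt0P[]; case/imsetP: eE => s _ ->; exists s; rewrite inE.
  have -> : edge_mult f g e = 0%N.
    apply: eq_card0 => s; rewrite !inE; apply: contraNF eE => /eqP <-.
    exact: imset_f.
  by rewrite /moment !expr0 !mulr1 addrC subrK normr1.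
rewrite -big_mkcond /= prodr_const.
apply: ler_wiXn2l => //; have := nvals_le_edges f g; rewrite -/E.
by case: (nvals f + nvals g)%N => [|v].
Qed.

Lemma first_occ_idem k (T : eqType) (f : 'I_k -> T) t :
  first_occ f (first_occ f t) = first_occ f t.
Proof. by have [ft _] := first_occP f t; apply/eqP; rewrite first_occ_eq ft. Qed.

(** A map with kernel [c] is determined by its values at the first occurrences. *)
Lemma card_first_occ_le k m d (c : {ffun 'I_k -> 'I_k}) : (m <= d)%N ->
  (#|[pred f : {ffun 'I_k -> 'I_m} | first_occ f == c]| <= d ^ nvals c)%N.
Proof.
move=> md; pose D := {t : 'I_k | first_occ c t == t}.
pose h (f : {ffun 'I_k -> 'I_m}) : {ffun D -> 'I_m} := [ffun x => f (val x)].
pose A := [set f : {ffun 'I_k -> 'I_m} | first_occ f == c].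
have -> : #|[pred f : {ffun 'I_k -> 'I_m} | first_occ f == c]| = #|h @: A|.
  rewrite card_in_imset ?cardsE // => f f'; rewrite !inE => /eqP fc /eqP f'c hff'.
  apply/ffunP => t; have [ft _] := first_occP f t; have [f't _] := first_occP f' t.
  have Dt : first_occ c (first_occ c t) == first_occ c t.
    by rewrite -fc first_occK first_occ_idem.
  have hE u : h u (exist _ (first_occ c t) Dt) = u (first_occ c t) by rewrite ffunE.
  have e1 : first_occ c t = first_occ f t by rewrite -fc first_occK.
  have e2 : first_occ c t = first_occ f' t by rewrite -f'c first_occK.
  by rewrite -ft -e1 -hE hff' hE e2 f't.
rewrite (leq_trans (max_card _)) // card_ffun card_ord card_sig -/(nvals c).
by case: (posnP (nvals c)) => [->//|c0]; rewrite leq_exp2r.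
Qed.

(** Injective labellings of the at most [k] classes from [2 * k] labels: each choice still has at
    least [k + 1] labels left. This is why the comparison matrix has size twice the number of row
    visits. *)
Lemma card_first_occ_ge k (T : eqType) (f0 : 'I_k -> T) :
  (k.+1 ^ nvals f0 <=
   #|[pred f : {ffun 'I_k -> 'I_(2 * k)} | first_occ f == first_occ f0]|)%N.
Proof.
pose c := first_occ f0; pose D := {t : 'I_k | c t == t}.
have cD t : c (c t) == c t by rewrite first_occ_idem.
pose h (u : {ffun D -> 'I_(2 * k)}) : {ffun 'I_k -> 'I_(2 * k)} :=
  [ffun t => u (exist _ (c t) (cD t))].
have hE u t : h u t = u (exist _ (c t) (cD t)) by rewrite ffunE.
pose A := [set u : {ffun D -> 'I_(2 * k)} | injectiveb u].
have cardA : #|A| = (2 * k) ^_ (nvals f0).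
  by rewrite card_inj_ffuns card_ord card_sig.
apply: (@leq_trans #|h @: A|); last first.
  apply: subset_leq_card; apply/subsetP => _ /imsetP[u uA ->]; rewrite inE.
  apply/eqP; apply: first_occ_ext => t t'; rewrite !hE.
  move: uA; rewrite inE => /injectiveP u_inj.
  have uE (a b : D) : (u a == u b) = (val a == val b).
    by apply/eqP/eqP => [/u_inj ->//|/val_inj ->].
  by rewrite uE /= first_occ_eq.
rewrite card_in_imset => [|u u' _ _ huu']; last first.
  apply/ffunP => -[t ct]; have /ffunP/(_ t) := huu'; rewrite !hE.
  have -> // : exist _ (c t) (cD t) = exist _ t ct :> D by apply: val_inj; apply/eqP.
rewrite cardA ffact_prod -[X in (_ ^ X)%N]card_ord -prod_nat_const.
apply: leq_prod => i _; have := nvals_le f0; have := ltn_ord i; lia.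
Qed.

(** A shape with [v] vertices contributes at most [d ^ v * theta ^ (v - 1)] on the left. On the
    right it has at least [(k + 2) ^ v] labellings, each worth at least 1. The hypothesis
    [theta * d <= k + 2] compares the two with loss [d / (k + 2)]. *)
Lemma expect_walk_sum_le k m n d (p : 'I_m * 'I_n -> R) x theta q y :
  0 <= theta <= 1 -> theta * d%:R <= k.+2%:R -> (m <= d)%N -> (n <= d)%N ->
  (forall e, moment p x e 1 = 0) ->
  (forall e a, (2 <= a)%N -> `|moment p x e a| <= theta) ->
  (forall e, moment q y e 1 = 0) ->
  (forall e a, (2 <= a)%N -> 1 <= moment q y e a) ->
  expect p (fun w => walk_sum k.+1 (rand_mx x w)) <=
  d%:R / k.+2%:R * expect q (fun w =>
    walk_sum k.+1 (rand_mx (m := 2 * k.+1) (n := 2 * k.+1) y w)).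
Proof.
move=> th01 thd md nd m1 m2 q1 q2; have /andP[th0 th1] := th01.
rewrite !expect_walk_sum.
pose K : finType := {ffun 'I_k.+1 -> 'I_k.+1}.
pose N (r : nat) (c : K) : nat := #|[pred f : {ffun 'I_k.+1 -> 'I_r} | first_occ f == c]|.
have group (r s : nat) (h : K -> K -> R) :
    \sum_(f : {ffun 'I_k.+1 -> 'I_r}) \sum_(g : {ffun 'I_k.+1 -> 'I_s})
      h (first_occ f) (first_occ g) = \sum_c \sum_c' (N r c * N s c')%:R * h c c'.
  rewrite (partition_big (fun f : {ffun _} => first_occ f) predT) //=.
  apply: eq_bigr => c _.
  transitivity (\sum_(f : {ffun 'I_k.+1 -> 'I_r} | first_occ f == c)
      \sum_c' (N s c')%:R * h c c').
    apply: eq_bigr => f /eqP ->.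
    rewrite (partition_big (fun g : {ffun _} => first_occ g) predT) //=.
    apply: eq_bigr => c' _.
    under eq_bigr => g /eqP -> do [].
    by rewrite sumr_const mulr_natl.
  rewrite sumr_const -mulr_natl mulr_sumr; apply: eq_bigr => c' _.
  by rewrite natrM mulrA.
pose h1 (c c' : K) : R :=
  if twice_covered c c' then theta ^+ (nvals c + nvals c').-1 else 0.
pose h2 (c c' : K) : R := (twice_covered c c')%:R.
apply: (@le_trans _ _ (\sum_c \sum_c' (N m c * N n c')%:R * h1 c c')).
  rewrite -group; apply: ler_sum => f _; apply: ler_sum => g _.
  rewrite /h1 twice_covered_first_occ !nvals_first_occ.
  exact: walk_moment_le.
apply: (@le_trans _ _ (d%:R / k.+2%:R *
    (\sum_c \sum_c' (N (2 * k.+1) c * N (2 * k.+1) c')%:R * h2 c c'))); last first.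
  rewrite ler_wpM2l ?divr_ge0 ?ler0n // -group.
  apply: ler_sum => f _; apply: ler_sum => g _.
  rewrite /h2 twice_covered_first_occ; case: (boolP (twice_covered f g)) => ev.
    rewrite mulr1n; apply: (big_ind (fun z => 1 <= z)) => // [a b|e _].
      exact: mulr_ege1.
    case: (twice_covered_mult e ev) => [->|]; last exact: q2.
    by rewrite /moment !expr0 !mulr1 addrC subrK.
  (* Walks that are not twice covered may be dropped from the comparison side: each factor is 1, 0
     or at least 1, so the term is non-negative. *)
  rewrite mulr0n prodr_ge0 // => e _.
  case: (edge_mult f g e) => [|[|a]]; last by rewrite (le_trans ler01) // q2.
    by rewrite /moment !expr0 !mulr1 addrC subrK.
  by rewrite q1.
rewrite mulr_sumr; apply: ler_sum => c _; rewrite mulr_sumr; apply: ler_sum => c' _.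
rewrite /h1 /h2; case: ifPn => _; last by rewrite !mulr0.
rewrite mulr1; set v := (_ + _)%N.
have rhs0 (a b : nat) : 0 <= d%:R / k.+2%:R * (a * b)%:R :> R.
  by rewrite mulr_ge0 ?divr_ge0 ?ler0n.
(* A shape that no walk realises contributes nothing; otherwise a realising walk is needed to count
   labellings from below. *)
have [->|] := eqVneq (N m c) 0%N; first by rewrite mul0n mul0r.
rewrite -lt0n => /card_gt0P[f]; rewrite inE => /eqP fc.
have [->|] := eqVneq (N n c') 0%N; first by rewrite muln0 mul0r.
rewrite -lt0n => /card_gt0P[g]; rewrite inE => /eqP gc'.
have vfg : v = (nvals f + nvals g)%N by rewrite /v -fc -gc' !nvals_first_occ.
have v0 : (0 < v)%N by rewrite vfg addn_gt0 nvals_gt0.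
apply: (@le_trans _ _ ((d ^ v)%:R * theta ^+ v.-1)).
  rewrite ler_wpM2r ?exprn_ge0 // ler_nat /v expnD.
  by apply: leq_mul; exact: card_first_occ_le.
apply: (@le_trans _ _ (d%:R / k.+2%:R * (k.+2 ^ v)%:R)); last first.
  rewrite ler_wpM2l ?divr_ge0 ?ler0n // ler_nat vfg expnD.
  by rewrite /N -fc -gc'; apply: leq_mul; exact: card_first_occ_ge.
move: v0; clearbody v; clear vfg; case: v => // v _; rewrite !expnS !natrM -mulrA -[leRHS]mulrA.
rewrite ler_wpM2l ?ler0n // mulKf ?pnatr_eq0 // !natrX -exprMn /= mulrC.
by rewrite lerXn2r ?nnegrE ?mulr_ge0 ?ler0n.
Qed.

End Expectation.

(** * The comparison matrix *)

Section Comparison.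
Variable R : realType.

(** Averaged over a centred variable, the linear term disappears and a sub-Gaussian bound
    remains. *)
Lemma expR_le_quadratic (x : R) : expR x <= x + expR (3 * x ^+ 2).
Proof.
have e3 := expR_ge1Dx (3 * x ^+ 2); have x2 := sqr_ge0 x.
have [xl|xl] := leP x (- (1 / 3)).
  have : expR x <= 1 by rewrite expR_le1; lra.
  have : 0 <= (x + 1 / 3) * x by rewrite mulr_le0 //; lra.
  lra.
have [xr|xr] := leP (1 / 3) x.
  have : expR x <= expR (3 * x ^+ 2).
    rewrite ler_expR; have : 0 <= (x - 1 / 3) * x by rewrite mulr_ge0 //; lra.
    lra.
  lra.
suff : expR x <= 1 + x + 3 * x ^+ 2 by lra.
(* Near 0 the estimate comes from [expR (- (x / 2)) >= 1 - x / 2], squared. *)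
have h0 : 0 < 1 - x / 2 by lra.
have h : expR x * (1 - x / 2) ^+ 2 <= 1.
  have -> : expR x = expR (x / 2) ^+ 2.
    by rewrite expr2 -expRD; congr expR; field.
  rewrite -exprMn exprn_ile1 //; first by rewrite mulr_ge0 ?expR_ge0 // ltW.
  have := expR_ge1Dx (- (x / 2)); rewrite expRN -[leLHS]/(1 - x / 2) => h1.
  by rewrite mulrC -ler_pdivlMr ?expR_gt0 // div1r.
rewrite -(@ler_pM2r _ ((1 - x / 2) ^+ 2)) ?exprn_gt0 //; apply: (le_trans h).
rewrite -subr_ge0.
have -> : (1 + x + 3 * x ^+ 2) * (1 - x / 2) ^+ 2 - 1 =
   x ^+ 2 * (9 / 4 - 11 / 4 * x + 3 / 4 * x ^+ 2) by field.
by rewrite mulr_ge0 //; lra.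
Qed.

(* All moments of order at least 2 of this centred variable are at least 1, so that
   it dominates any centred variable bounded by 1 in the moment comparison. *)
Definition skew_coin (b : bool) : R := if b then 2 else - 1.

Lemma moment1_skew_coin (I : Type) (i : I) : moment (fun=> 3^-1) (fun=> skew_coin) i 1 = 0.
Proof. by rewrite /moment /skew_coin !expr1; field. Qed.

Lemma moment_skew_coin_ge1 (I : Type) (i : I) a : (2 <= a)%N ->
  1 <= moment (fun=> 3^-1) (fun=> skew_coin) i a.
Proof.
rewrite /moment /skew_coin; case: a => [|[|[|a]]] // _; first by lra.
have h2 : 8 <= 2 ^+ a.+3 :> R.
  have : 1 <= 2 ^+ a :> R by rewrite exprn_ege1 // ler1n.
  by rewrite !exprS; lra.
have h1 : -1 <= (-1) ^+ a.+3 :> R.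
  by rewrite -signr_odd; case: (odd _); rewrite ?expr1 ?expr0 //; lra.
by lra.
Qed.

(** The constant is [12 = 3 * 2 ^ 2], from the larger value 2 of the coin. *)
Lemma expect_expR_skew_coin (I : finType) (c : I -> R) :
  expect (fun=> 3^-1) (fun w => expR (\sum_i c i * skew_coin (w i))) <=
  expR (12 * \sum_i c i ^+ 2).
Proof.
have -> : (fun w : {ffun I -> bool} => expR (\sum_i c i * skew_coin (w i))) =
    (fun w => \prod_i expR (c i * skew_coin (w i))).
  by apply/funext => w; rewrite expR_sum.
rewrite (expect_prod (fun=> 3^-1) (fun i b => expR (c i * skew_coin b))) mulr_sumr expR_sum.
apply: ler_prod => i _; rewrite /skew_coin.
have h1 := expR_le_quadratic (c i * 2); have h2 := expR_le_quadratic (c i * -1).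
have h3 : expR (3 * (c i * -1) ^+ 2) <= expR (12 * c i ^+ 2).
  by rewrite ler_expR; have := sqr_ge0 (c i); lra.
have e4 : 3 * (c i * 2) ^+ 2 = 12 * c i ^+ 2 by ring.
rewrite e4 in h1; have := expR_ge0 (c i * 2); have := expR_ge0 (c i * -1).
by move=> ? ?; apply/andP; split; lra.
Qed.

(** This is [y <= expR y] at [y = lam * |x| / (2 a)], raised to the power [2 a]; it turns
    exponential moments into power moments. *)
Lemma pow_le_expR (x lam : R) a : 0 < lam -> (0 < a)%N ->
  x ^+ (2 * a) <= (2 * a%:R / lam) ^+ (2 * a) * (expR (lam * x) + expR (- (lam * x))).
Proof.
move=> lam0 a0; have a0' : 0 < (2 * a)%:R :> R by rewrite ltr0n muln_gt0.
have -> : x ^+ (2 * a) = `|x| ^+ (2 * a).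
  by rewrite exprM [RHS]exprM real_normK // num_real.
pose y := lam * `|x| / (2 * a)%:R.
have y0 : 0 <= y by rewrite divr_ge0 ?mulr_ge0 // ltW.
have hy : y ^+ (2 * a) <= expR (lam * `|x|).
  have -> : lam * `|x| = (2 * a)%:R * y by rewrite /y [RHS]mulrC divfK ?gt_eqF.
  rewrite expRM_natl lerXn2r ?nnegrE ?expR_ge0 //.
  by have := expR_ge1Dx y; lra.
have -> : `|x| = 2 * a%:R / lam * y.
  by rewrite /y natrM; field; rewrite !gt_eqF // ltr0n.
rewrite exprMn; apply: ler_wpM2l.
  by rewrite exprn_ge0 // divr_ge0 ?mulr_ge0 ?ler0n // ltW.
apply: (le_trans hy); have [x0|x0] := ger0P x; last rewrite mulrN.
  by rewrite lerDl expR_ge0.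
by rewrite lerDr expR_ge0.
Qed.

Lemma expect_pow_skew_coin (I : finType) (c : I -> R) lam a : 0 < lam -> (0 < a)%N ->
  expect (fun=> 3^-1) (fun w => (\sum_i c i * skew_coin (w i)) ^+ (2 * a)) <=
  (2 * a%:R / lam) ^+ (2 * a) * (2 * expR (12 * (lam ^+ 2 * \sum_i c i ^+ 2))).
Proof.
move=> lam0 a0; set B := (2 * a%:R / lam) ^+ (2 * a).
have B0 : 0 <= B by rewrite exprn_ge0 // divr_ge0 ?mulr_ge0 ?ler0n // ltW.
have expectD (F G : {ffun I -> bool} -> R) :
    expect (fun=> 3^-1) (fun w => F w + G w) = expect (fun=> 3^-1) F + expect (fun=> 3^-1) G.
  by rewrite /expect -big_split; apply: eq_bigr => w _; rewrite mulrDr.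
apply: (@le_trans _ _ (expect (fun=> 3^-1) (fun w => B *
    (expR (\sum_i (lam * c i) * skew_coin (w i)) +
     expR (\sum_i (- (lam * c i)) * skew_coin (w i)))))).
  apply: expect_le => [_|w]; first by lra.
  under [X in expR X + _]eq_bigr do rewrite -mulrA.
  under [X in _ + expR X]eq_bigr do rewrite mulNr -mulrA.
  by rewrite sumrN -!mulr_sumr; exact: pow_le_expR.
rewrite expectZ ler_wpM2l // expectD.
have e1 (c' : I -> R) : (forall i, c' i ^+ 2 = lam ^+ 2 * c i ^+ 2) ->
    expect (fun=> 3^-1) (fun w => expR (\sum_i c' i * skew_coin (w i))) <=
    expR (12 * (lam ^+ 2 * \sum_i c i ^+ 2)).
  move=> c'E; apply: (le_trans (expect_expR_skew_coin _)).
  by rewrite (eq_bigr (fun i => lam ^+ 2 * c i ^+ 2)) // -mulr_sumr.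
have h1 := e1 (fun i => lam * c i) (fun i => exprMn _ _ _).
have h2 := e1 (fun i => - (lam * c i)) (fun i => etrans (sqrrN _) (exprMn _ _ _)).
by rewrite mulr2n mulrDl !mul1r lerD.
Qed.

End Comparison.

(** * A lattice net for the norm of a square matrix *)

Section Net.
Variable R : realType.

Definition signed_vec N B (z : {ffun 'I_N -> bool * 'I_B}) : 'cV[R]_N :=
  \col_i ((-1) ^+ (z i).1 * (z i).2%:R).

(** Integer vectors in the ball of radius [2 sqrt N]. The cap [4 * N] on a coordinate follows from
    the norm bound and only makes the type finite; zero coordinates have two encodings, harmless
    since only an upper bound on the cardinality is used. *)
Definition net N :=
  [set z : {ffun 'I_N -> bool * 'I_(4 * N).+1} | (\sum_i (z i).2 ^ 2 <= 4 * N)%N].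

Lemma net_nf2 N z : z \in net N -> nf2 (signed_vec z) <= 4 * N%:R.
Proof.
rewrite inE -(ler_nat R) natrM natr_sum; apply: le_trans.
rewrite nf2_cV; apply: ler_sum => i _.
by rewrite mxE exprMn sqrr_sign mul1r natrX.
Qed.

(** Weigh a vector by [2 ^ (- sum a_i)]. On the net [sum a_i <= sum a_i ^ 2 <= 4 N], so [16 ^ N]
    times the weight is at least 1, while the total weight is at most [4 ^ N]. *)
Lemma card_net N : #|net N|%:R <= 64 ^+ N :> R.
Proof.
pose wt (a : 'I_(4 * N).+1) : R := 2^-1 ^+ a.
have wt0 a : 0 <= wt a by rewrite exprn_ge0 ?invr_ge0.
have sumwt : \sum_(ba : bool * 'I_(4 * N).+1) wt ba.2 <= 4.
  rewrite -(pair_bigA _ (fun (b : bool) a => wt a)) /= big_bool /=.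
  suff : \sum_(a < (4 * N).+1) wt a <= 2 by lra.
  rewrite /wt; elim: (_).+1 => [|j IHj]; first by rewrite big_ord0.
  have -> : \sum_(a < j.+1) 2^-1 ^+ a = 2 - 2 * 2^-1 ^+ j.+1 :> R.
    elim: j {IHj} => [|j IHj]; first by rewrite big_ord1 expr0 expr1; field.
    by rewrite big_ord_recr /= IHj !exprS; field.
  by rewrite lerBlDr lerDl mulr_ge0 // exprn_ge0 ?invr_ge0.
apply: (@le_trans _ _ (\sum_(z : {ffun 'I_N -> bool * 'I_(4 * N).+1})
    16 ^+ N * \prod_i wt (z i).2)).
  rewrite -sum1_card natr_sum [leRHS](bigID (mem (net N))) /=.
  rewrite -[leLHS]addr0 lerD //; last first.
    by rewrite sumr_ge0 // => z _; rewrite mulr_ge0 ?exprn_ge0 // prodr_ge0.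
  apply: ler_sum => z; rewrite inE => hz.
  rewrite prodrXr (_ : 16 = 2 ^+ 4); last by ring.
  rewrite -exprM exprVn ler_pdivlMr ?exprn_gt0 // mul1r ler_weXn2l ?ler1n //.
  apply: leq_trans hz; apply: leq_sum => i _.
  by rewrite -mulnn; case: (nat_of_ord _) => // j; rewrite leq_pmulr.
rewrite -mulr_sumr -(bigA_distr_bigA (fun (i : 'I_N) ba => wt ba.2)) /=.
rewrite prodr_const card_ord -exprMn lerXn2r ?nnegrE ?mulr_ge0 ?sumr_ge0 //.
by lra.
Qed.

(* [z] truncates [2 sqrt N w / |w|] towards zero; since [|w|_1 <= sqrt N |w|], the
   rounding costs at most half of the inner product. *)
Lemma net_approx N (w : 'cV[R]_N) :
  exists2 z, z \in net N &
    Num.sqrt N%:R * Num.sqrt (nf2 w) <= \sum_i signed_vec z i 0 * w i 0.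
Proof.
have [w0|w0] := eqVneq (nf2 w) 0.
  exists [ffun=> (false, ord0)].
    by rewrite inE big1 // => i _; rewrite ffunE.
  by rewrite w0 sqrtr0 mulr0 (nf2_eq0 w0) sumr_ge0 // => i _; rewrite [X in _ * X]mxE mulr0.
have N0 : (0 < N)%N.
  by case: N w w0 => // w; rewrite nf2_cV big_ord0 eqxx.
set S := Num.sqrt N%:R; set W := Num.sqrt (nf2 w).
have S0 : 0 < S by rewrite sqrtr_gt0 ltr0n.
have W0 : 0 < W by rewrite sqrtr_gt0 lt_def w0 nf2_ge0.
have S2 : S ^+ 2 = N%:R by rewrite sqr_sqrtr ?ler0n.
have W2 : W ^+ 2 = \sum_i w i 0 ^+ 2 by rewrite sqr_sqrtr ?nf2_ge0 // nf2_cV.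
pose a i := Num.truncn (2 * S * `|w i 0| / W).
have arg0 i : 0 <= 2 * S * `|w i 0| / W.
  by rewrite divr_ge0 ?mulr_ge0 // ltW.
have a_le i : (a i)%:R <= 2 * S * `|w i 0| / W by rewrite truncn_le.
have a_gt i : 2 * S * `|w i 0| / W < (a i)%:R + 1.
  by rewrite natr1; exact: truncnS_gt.
have sum_a : (\sum_i a i ^ 2 <= 4 * N)%N.
  rewrite -(ler_nat R) natr_sum natrM -S2.
  apply: (@le_trans _ _ (\sum_i 4 * S ^+ 2 / W ^+ 2 * w i 0 ^+ 2)).
    apply: ler_sum => i _; rewrite natrX.
    have -> : 4 * S ^+ 2 / W ^+ 2 * w i 0 ^+ 2 = (2 * S * `|w i 0| / W) ^+ 2.
      rewrite -[w i 0 ^+ 2]real_normK ?num_real //; field; exact: lt0r_neq0.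
    by rewrite lerXn2r ?nnegrE ?ler0n.
  by rewrite -mulr_sumr -W2 divfK // expf_neq0 // lt0r_neq0.
have a_lt i : (a i < (4 * N).+1)%N.
  rewrite ltnS (leq_trans _ sum_a) // (bigD1 i) //= (leq_trans _ (leq_addr _ _)) //.
  by rewrite -mulnn; case: (a i) => // j; rewrite leq_pmulr.
exists [ffun i => (w i 0 < 0, Ordinal (a_lt i))].
  by rewrite inE; under eq_bigr do rewrite ffunE.
have zE i : signed_vec [ffun i => (w i 0 < 0, Ordinal (a_lt i))] i 0 * w i 0 =
    (a i)%:R * `|w i 0|.
  rewrite mxE ffunE /=; case: ltrP => h; first by rewrite expr1 ltr0_norm //; ring.
  by rewrite expr0 ger0_norm //; ring.
rewrite (eq_bigr _ (fun i _ => zE i)).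
(* The subtracted term majorises [|w i 0|] by the arithmetic-geometric mean inequality and sums to
   [S * W], which is Cauchy-Schwarz one coordinate at a time. *)
apply: (@le_trans _ _ (\sum_i (2 * S / W * w i 0 ^+ 2 -
   (S / W * w i 0 ^+ 2 + W / S) / 2))).
  rewrite sumrB -mulr_sumr -mulr_suml big_split /= -mulr_sumr -W2 sumr_const card_ord.
  rewrite -[_ *+ N]mulr_natr -S2 le_eqVlt; apply/orP; left; apply/eqP.
  by field; rewrite !lt0r_neq0.
apply: ler_sum => i _.
have sq : w i 0 ^+ 2 = `|w i 0| ^+ 2 by rewrite real_normK ?num_real.
apply: (@le_trans _ _ ((2 * S * `|w i 0| / W - 1) * `|w i 0|)); last first.
  by rewrite ler_wpM2r // lerBlDr ltW.
rewrite sq -subr_ge0.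
have -> : (2 * S * `|w i 0| / W - 1) * `|w i 0| -
   (2 * S / W * `|w i 0| ^+ 2 - (S / W * `|w i 0| ^+ 2 + W / S) / 2) =
   (S * `|w i 0| - W) ^+ 2 / (2 * S * W) by field; rewrite !lt0r_neq0.
by rewrite divr_ge0 ?sqr_ge0 // !mulr_ge0 // ltW.
Qed.

(** Rounding is applied twice. First [z] is chosen for the top left vector [u], so that [M^T z] has
    inner product at least [sqrt N * s 0] with the top right vector [v], hence at least that norm;
    then [z'] is chosen for [M^T z]. *)
Lemma svd_net N (M : 'M[R]_N) U V s : is_svd M U V s -> (0 < N)%N ->
  exists z z', [/\ z \in net N, z' \in net N &
    N%:R * s 0%N <= \sum_i \sum_j signed_vec z i 0 * M i j * signed_vec z' j 0].
Proof.
move=> hM N0; have [[oU oV] s0 _ _ _] := hM; pose o := Ordinal N0.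
have colu : nf2 (col o U) = 1.
  rewrite (cV_nf2_entry _ (leqnn N)) -(sum_sqr_col_orthogonal oU (leqnn N) N0).
  apply: eq_big_nat => i /andP[_ ni].
  by rewrite (entryE _ (Ordinal ni) 0) mxE -entryE.
have colv : nf2 (col o V) = 1.
  rewrite (cV_nf2_entry _ (leqnn N)) -(sum_sqr_col_orthogonal oV (leqnn N) N0).
  apply: eq_big_nat => i /andP[_ ni].
  by rewrite (entryE _ (Ordinal ni) 0) mxE -entryE.
have Mv : M *m col o V = s 0%N *: col o U.
  rewrite (svd_eq hM) !colE -!mulmxA (mulmxA V^T) (orthogonal_mxVl oV) mul1mx scalemxAr.
  congr (_ *m _); apply/matrixP => i j; rewrite ord1 mxE (bigD1 o) //= big1 => [|k ko].
    by rewrite !mxE !eqxx -val_eqE /=; case: eqVneq => [->|]; rewrite ?mulr1 ?mulr0 ?mul0r addr0.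
  by rewrite [X in _ * X]mxE (negbTE ko) mulr0.
have [z zN hz] := net_approx (col o U); rewrite colu sqrtr1 mulr1 in hz.
pose w := M^T *m signed_vec z.
have [z' z'N hz'] := net_approx w.
exists z, z'; split=> //.
have -> : \sum_i \sum_j signed_vec z i 0 * M i j * signed_vec z' j 0 =
    \sum_j signed_vec z' j 0 * w j 0.
  rewrite exchange_big; apply: eq_bigr => j _; rewrite [w _ _]mxE mulr_sumr.
  by apply: eq_bigr => i _; rewrite [M^T _ _]mxE; ring.
apply: le_trans hz'.
have S2 : N%:R = Num.sqrt N%:R ^+ 2 :> R by rewrite sqr_sqrtr ?ler0n.
rewrite {1}S2 expr2 -mulrA ler_wpM2l ?sqrtr_ge0 //.
have tr1 (a b : 'cV[R]_N) : \tr (a *m b^T) = \sum_i a i 0 * b i 0.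
  by apply: eq_bigr => i _; rewrite mxE big_ord1 mxE.
have wv : \tr (w *m (col o V)^T) = s 0%N * \sum_i signed_vec z i 0 * col o U i 0.
  rewrite mxtrace_mulC -mxtrace_tr !trmx_mul !trmxK -mulmxA Mv linearZ /= mxtraceZ.
  by rewrite mxtrace_mulC -mxtrace_tr trmx_mul trmxK tr1.
have hwv : Num.sqrt N%:R * s 0%N <= \tr (w *m (col o V)^T).
  by rewrite wv mulrC ler_wpM2l.
apply: (le_trans hwv); set t := \tr _ in hwv *.
have t0 : 0 <= t by apply: le_trans hwv; rewrite mulr_ge0 ?sqrtr_ge0.
(* Cauchy-Schwarz against the unit vector [col o V], by subtracting from [w] its projection. *)
rewrite -(@ler_pXn2r _ 2) ?nnegrE ?sqrtr_ge0 // sqr_sqrtr ?nf2_ge0 //.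
have := nf2_ge0 (w - t *: col o V).
rewrite nf2D nf2N nf2Z colv linearN /= mulmxN linearN /= linearZ /= -scalemxAr mxtraceZ -/t.
by lra.
Qed.

End Net.

(** * Moments of the comparison matrix *)

Section IID.
Variable R : realType.

Lemma walk_sum_le_net k N (M : 'M[R]_N) : (0 < N)%N ->
  walk_sum k.+1 M <= N%:R / N%:R ^+ (2 * k.+1) *
    \sum_(z in net N) \sum_(z' in net N)
      (\sum_i \sum_j signed_vec R z i 0 * M i j * signed_vec R z' j 0) ^+ (2 * k.+1).
Proof.
move=> N0; have [U [V [s hM]]] := svd_exists M; have [_ s0 _ _ _] := hM.
apply: (le_trans (walk_sum_le k hM)); rewrite -mulrA ler_wpM2l ?ler0n //.
have NR : 0 < N%:R ^+ (2 * k.+1) :> R by rewrite exprn_gt0 // ltr0n.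
rewrite mulrC ler_pdivlMr // mulrC -exprMn.
have [z [z' [zN z'N h]]] := svd_net hM N0.
have pos (x : R) : 0 <= x ^+ (2 * k.+1) by rewrite exprM exprn_ge0 // sqr_ge0.
rewrite (bigD1 z) //= (bigD1 z') //= -addrA.
apply: ler_wpDr; first by rewrite addr_ge0 // ?sumr_ge0 // => *; rewrite ?sumr_ge0.
by rewrite lerXn2r ?nnegrE ?mulr_ge0 ?ler0n // (le_trans _ h) // mulr_ge0 ?ler0n.
Qed.

(** Per unit of [k.+1]: [64 ^ 4] counts pairs of net vectors in dimension [2 * k.+1], a further 64
    is [256 / 4] from [(2 * k.+1%:R / lam) ^+ 2] over the squared dimension, and [expR 12] is the
    sub-Gaussian factor. *)
Definition iid_const : R := 64 ^+ 5 * expR 12.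

Lemma expect_walk_sum_skew_coin k (N := (2 * k.+1)%N) :
  expect (fun=> 3^-1) (fun w => walk_sum k.+1 (rand_mx (m := N) (n := N) (fun=> @skew_coin R) w)) <=
  4 * k.+1%:R * (iid_const * k.+1%:R) ^+ k.+1.
Proof.
have N0 : (0 < N)%N by [].
have K0 : 0 < k.+1%:R :> R by rewrite ltr0n.
set p := (X in expect X _); have p01 e : 0 <= p e <= 1 by rewrite /p; apply/andP; split; lra.
pose c (z z' : {ffun 'I_N -> bool * 'I_(4 * N).+1}) (e : 'I_N * 'I_N) : R :=
  signed_vec R z e.1 0 * signed_vec R z' e.2 0.
apply: (@le_trans _ _ (expect p (fun w => N%:R / N%:R ^+ (2 * k.+1) *
   \sum_(z in net N) \sum_(z' in net N) (\sum_e c z z' e * skew_coin R (w e)) ^+ (2 * k.+1)))).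
  apply: expect_le => // w.
  apply: (le_trans (walk_sum_le_net k _ N0)); rewrite le_eqVlt; apply/orP; left; apply/eqP.
  congr (_ * _); apply: eq_bigr => z _; apply: eq_bigr => z' _; congr (_ ^+ _).
  rewrite pair_bigA; apply: eq_bigr => -[i j] _; rewrite /c /rand_mx /= [X in _ * X * _]mxE.
  by rewrite mulrAC.
(* Chosen so that [lam ^+ 2 * (4 * N) ^ 2 = k.+1], which balances the exponential factor against the
   power. *)
pose lam : R := (8 * Num.sqrt k.+1%:R)^-1.
have sK : 0 < Num.sqrt k.+1%:R :> R by rewrite sqrtr_gt0.
have lam0 : 0 < lam by rewrite invr_gt0 mulr_gt0.
have lam2 : lam ^+ 2 = (64 * k.+1%:R)^-1.
  by rewrite /lam exprVn exprMn sqr_sqrtr ?ler0n //; congr (_^-1); ring.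
pose beta : R := (2 * k.+1%:R / lam) ^+ (2 * k.+1) * (2 * expR 12 ^+ k.+1).
have hb z z' : z \in net N -> z' \in net N ->
    expect p (fun w => (\sum_e c z z' e * skew_coin R (w e)) ^+ (2 * k.+1)) <= beta.
  move=> zN z'N; apply: (le_trans (expect_pow_skew_coin _ lam0 _)) => //.
  rewrite ler_wpM2l ?exprn_ge0 ?divr_ge0 ?mulr_ge0 ?(ltW lam0) ?(ltW K0) //.
  rewrite ler_wpM2l // -expRM_natl ler_expR mulrC ler_wpM2r //.
  have -> : \sum_e c z z' e ^+ 2 = nf2 (signed_vec R z) * nf2 (signed_vec R z').
    rewrite !nf2_cV mulr_suml.
    rewrite -(pair_bigA _ (fun i j => (signed_vec R z i 0 * signed_vec R z' j 0) ^+ 2)) /=.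
    by apply: eq_bigr => i _; rewrite mulr_sumr; apply: eq_bigr => j _; rewrite exprMn.
  apply: (@le_trans _ _ (lam ^+ 2 * ((4 * N%:R) * (4 * N%:R)))).
    by rewrite ler_wpM2l ?sqr_ge0 // ler_pM ?nf2_ge0 ?net_nf2.
  rewrite lam2 /N natrM le_eqVlt; apply/orP; left; apply/eqP.
  by move: (k.+1%:R : R) K0 => K K0'; field; exact: lt0r_neq0.
have beta0 : 0 <= beta.
  by rewrite mulr_ge0 ?exprn_ge0 ?divr_ge0 ?mulr_ge0 ?expR_ge0 ?exprn_ge0 ?(ltW lam0)
    ?(ltW K0) ?expR_ge0.
rewrite expectZ expect_sum.
apply: (@le_trans _ _ (N%:R / N%:R ^+ (2 * k.+1) * (64 ^+ N * (64 ^+ N * beta)))).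
  rewrite ler_wpM2l ?divr_ge0 ?exprn_ge0 ?ler0n //.
  apply: (@le_trans _ _ (\sum_(z in net N) 64 ^+ N * beta)).
    apply: ler_sum => z zN; rewrite expect_sum.
    apply: (@le_trans _ _ (\sum_(z' in net N) beta)).
      by apply: ler_sum => z' z'N; exact: hb.
    by rewrite sumr_const -[leLHS]mulr_natl ler_wpM2r // card_net.
  rewrite sumr_const -[leLHS]mulr_natl; apply: ler_wpM2r; last exact: card_net.
  by rewrite mulr_ge0 ?exprn_ge0.
rewrite le_eqVlt; apply/orP; left; apply/eqP.
have -> : beta = (256 * k.+1%:R ^+ 3 * expR 12) ^+ k.+1 * 2.
  rewrite /beta exprM expr_div_n lam2 mulrCA mulrC; congr (_ * _); rewrite -exprMn.
  by congr (_ ^+ _); rewrite invrK; ring.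
have -> : 64 ^+ N = (64 ^+ 2) ^+ k.+1 :> R by rewrite -exprM.
have -> : N%:R ^+ (2 * k.+1) = (4 * k.+1%:R ^+ 2) ^+ k.+1 :> R.
  by rewrite exprM; congr (_ ^+ _); rewrite /N natrM; ring.
rewrite /N natrM -exprVn.
have -> : iid_const * k.+1%:R =
    (4 * k.+1%:R ^+ 2)^-1 * (64 ^+ 2 * (64 ^+ 2 * (256 * k.+1%:R ^+ 3 * expR 12))).
  by rewrite /iid_const; move: (k.+1%:R : R) K0 => K K0'; field; exact: lt0r_neq0.
by rewrite !exprMn; ring.
Qed.

End IID.

(** * The sampling error *)

Section Sampling.
Variable R : realType.

(** Cauchy-Schwarz over at most [d ^ 2] entries, done entrywise by the arithmetic-geometric mean
    inequality. *)
Lemma l1norm_le m n (A : 'M[R]_(m, n)) d : (m <= d)%N -> (n <= d)%N -> 0 < frob A ->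
  l1norm A <= d%:R * frob A.
Proof.
move=> md nd F0; set F := frob A in F0 *.
have d0 : 0 < d%:R :> R.
  rewrite ltr0n lt0n; apply: contraTneq F0 => d0.
  suff -> : F = 0 by rewrite ltxx.
  apply/eqP; rewrite -sqrf_eq0 sqr_frob /nf2 big1 // => i _.
  by have := leq_trans (ltn_ord i) md; rewrite d0.
pose c : R := d%:R.
apply: (@le_trans _ _ (\sum_i \sum_j (c / (2 * F) * A i j ^+ 2 + F / (2 * c)))).
  apply: ler_sum => i _; apply: ler_sum => j _.
  rewrite -[A i j ^+ 2]real_normK ?num_real // -subr_ge0.
  have -> : c / (2 * F) * `|A i j| ^+ 2 + F / (2 * c) - `|A i j| =
    (c * `|A i j| - F) ^+ 2 / (2 * c * F) by field; rewrite !lt0r_neq0.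
  by rewrite divr_ge0 ?sqr_ge0 // !mulr_ge0 // ltW.
have -> : \sum_(i < m) \sum_(j < n) (c / (2 * F) * A i j ^+ 2 + F / (2 * c)) =
    c / (2 * F) * F ^+ 2 + F / (2 * c) * (m * n)%:R.
  under eq_bigr do rewrite big_split /= -mulr_sumr sumr_const card_ord.
  rewrite big_split /= -mulr_sumr -/(nf2 A) -sqr_frob -/F sumr_const card_ord.
  by rewrite -mulrnA mulr_natr mulnC.
apply: (@le_trans _ _ (c / (2 * F) * F ^+ 2 + F / (2 * c) * (c * c))); last first.
  by rewrite le_eqVlt; apply/orP; left; apply/eqP; rewrite /c; field; rewrite !lt0r_neq0.
rewrite lerD2l; apply: ler_wpM2l; first by rewrite divr_ge0 ?mulr_ge0 // ltW.
by rewrite /c -natrM ler_nat leq_mul.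
Qed.

Variables (m n : nat) (A : 'M[R]_(m, n)) (nn : R).
Hypotheses (nn0 : 0 < nn) (F0 : 0 < frob A).

Let d := maxn m n.
Let p := samp_prob A nn.
Let L : R := 2 * d%:R * frob A / nn.

Definition centered_entry (e : 'I_m * 'I_n) (b : bool) : R :=
  L^-1 * ((if b then A e.1 e.2 / p e.1 e.2 else 0) - A e.1 e.2).

Let pe (e : 'I_m * 'I_n) : R := p e.1 e.2.

Lemma samp_prob01 i j : 0 <= p i j <= 1.
Proof.
rewrite /p /samp_prob ge_min lexx orbT andbT le_min ler01 andbT.
rewrite mulr_ge0 ?divr_ge0 ?addr_ge0 ?divr_ge0 ?sqr_ge0 //; first exact: ltW.
by rewrite sumr_ge0 // => k _; rewrite sumr_ge0.
Qed.

Lemma max_dim_gt0 : 0 < d%:R :> R.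
Proof.
rewrite ltr0n lt0n; apply: contraTneq F0 => d0.
suff -> : frob A = 0 by rewrite ltxx.
apply/eqP; rewrite -sqrf_eq0 sqr_frob /nf2 big1 // => i _.
by have := leq_trans (ltn_ord i) (leq_maxl m n); rewrite -/d d0.
Qed.

Lemma scale_gt0 : 0 < L.
Proof. by rewrite divr_gt0 // !mulr_gt0 // max_dim_gt0. Qed.

Lemma rand_mx_centered w : rand_mx centered_entry w = L^-1 *: (P_Omega A p w - A).
Proof. by apply/matrixP => i j; rewrite !mxE. Qed.

(** Randomness occurs only in the third case, where dropping one summand of the probability at a
    time gives the two bounds: the [l1norm] summand bounds the size, the Frobenius one the variance.
    The first case is where the [0 / 0] convention acts. *)
Lemma samp_prob_cases i j :
  [\/ A i j = 0 /\ p i j = 0, p i j = 1 |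
   [/\ 0 < p i j < 1, `|A i j| / p i j <= L &
       A i j ^+ 2 / p i j <= 2 * frob A ^+ 2 / nn]].
Proof.
set a := A i j.
have [a0|aN0] := eqVneq a 0.
  constructor 1; split=> //; rewrite /p /samp_prob -/a a0 expr0n normr0 !mul0r addr0 mulr0.
  by rewrite min_l.
have l1a : `|a| <= l1norm A.
  rewrite /l1norm (bigD1 i) //= (bigD1 j) //= -addrA lerDl addr_ge0 //.
    by rewrite sumr_ge0.
  by rewrite sumr_ge0 // => k _; rewrite sumr_ge0.
have a_gt0 : 0 < `|a| by rewrite normr_gt0.
have l1_gt0 : 0 < l1norm A by exact: lt_le_trans l1a.
have [p1|p1] := leP 1 (nn / 2 * (a ^+ 2 / frob A ^+ 2 + `|a| / l1norm A)).
  by constructor 2; rewrite /p /samp_prob min_r.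
have pE : p i j = nn / 2 * (a ^+ 2 / frob A ^+ 2 + `|a| / l1norm A).
  by rewrite /p /samp_prob min_l // ltW.
have h1 : 0 < a ^+ 2 / frob A ^+ 2.
  by apply: divr_gt0; [rewrite lt_def sqrf_eq0 aN0 sqr_ge0|exact: exprn_gt0].
have h2 : 0 < `|a| / l1norm A by rewrite divr_gt0.
have h : 0 < p i j by rewrite pE mulr_gt0 ?divr_gt0 ?addr_gt0.
constructor 3; split; first by rewrite h pE.
- rewrite ler_pdivrMr //.
  apply: (@le_trans _ _ (L * (nn / 2 * (`|a| / l1norm A)))); last first.
    rewrite pE; apply: ler_wpM2l; first exact: ltW scale_gt0.
    by apply: ler_wpM2l; [rewrite divr_ge0 // ltW | rewrite lerDr ltW].
  have -> : L * (nn / 2 * (`|a| / l1norm A)) = `|a| * (d%:R * frob A / l1norm A).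
    by rewrite /L; field; rewrite !lt0r_neq0.
  rewrite ler_peMr // ler_pdivlMr // mul1r.
  exact: l1norm_le (leq_maxl _ _) (leq_maxr _ _) F0.
rewrite ler_pdivrMr //.
apply: (@le_trans _ _ (2 * frob A ^+ 2 / nn * (nn / 2 * (a ^+ 2 / frob A ^+ 2)))); last first.
  rewrite pE; apply: ler_wpM2l; first by rewrite divr_ge0 ?mulr_ge0 ?sqr_ge0 // ltW.
  by apply: ler_wpM2l; [rewrite divr_ge0 // ltW | rewrite lerDl ltW].
by rewrite le_eqVlt; apply/orP; left; apply/eqP; field; rewrite !lt0r_neq0.
Qed.

Lemma moment1_centered e : moment pe centered_entry e 1 = 0.
Proof.
case: e => i j; rewrite /moment /centered_entry /pe /= !expr1 sub0r.
have [[-> ->]|->|[/andP[p0 p1] _ _]] := samp_prob_cases i j.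
- by rewrite oppr0 !mulr0 addr0 mul0r.
- by rewrite divr1; ring.
by field; rewrite !lt0r_neq0 // scale_gt0.
Qed.

(** Both values of the entry are at most 1 in absolute value, so every higher moment is bounded by
    the variance. *)
Lemma moment_centered_le e a : (2 <= a)%N ->
  `|moment pe centered_entry e a| <= Num.min 1 (nn / (2 * d%:R ^+ 2)).
Proof.
move=> a2; have min0 : 0 <= Num.min 1 (nn / (2 * d%:R ^+ 2)).
  by rewrite le_min ler01 divr_ge0 ?mulr_ge0 ?sqr_ge0 // ltW.
have a0 : (a == 0)%N = false by case: a a2.
case: e => i j; rewrite /moment /centered_entry /pe /=.
have [[-> ->]|->|[/andP[p0 p1] hL hF]] := samp_prob_cases i j.
- by rewrite !mul0r !subr0 !mulr0 expr0n a0 mulr0 addr0 normr0.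
- by rewrite divr1 !subrr !mulr0 expr0n a0 mulr0 mul0r addr0 normr0.
have L0 := scale_gt0.
set q := p i j in p0 p1 hL hF *; set z := A i j in hL hF *.
set y1 := L^-1 * (z / q - z); set y0 := L^-1 * (0 - z).
have Lq : `|z| <= L * q by move: hL; rewrite ler_pdivrMr.
have ny1 : `|y1| <= 1.
  have -> : y1 = (L * q)^-1 * ((1 - q) * z) by rewrite /y1; field; rewrite !lt0r_neq0.
  rewrite !normrM normfV (gtr0_norm (mulr_gt0 L0 p0)) ler_pdivrMl; last exact: mulr_gt0.
  rewrite mulr1; apply: le_trans Lq; rewrite ger0_norm; last by lra.
  by rewrite ler_piMl //; lra.
have ny0 : `|y0| <= 1.
  rewrite /y0 sub0r normrM normrN normfV (gtr0_norm L0) ler_pdivrMl // mulr1.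
  by apply: (le_trans Lq); rewrite ler_piMr // ltW.
apply: (@le_trans _ _ (q * y1 ^+ 2 + (1 - q) * y0 ^+ 2)).
  apply: (le_trans (ler_normD _ _)); rewrite !normrM !normrX (gtr0_norm p0).
  rewrite (@ger0_norm _ (1 - q)); last by lra.
  by rewrite -[y1 ^+ 2]real_normK ?num_real // -[y0 ^+ 2]real_normK ?num_real //;
    rewrite lerD // ler_wpM2l ?ler_wiXn2l //; lra.
have s1 : y1 ^+ 2 <= 1 by rewrite -[y1 ^+ 2]real_normK ?num_real // exprn_ile1.
have s0 : y0 ^+ 2 <= 1 by rewrite -[y0 ^+ 2]real_normK ?num_real // exprn_ile1.
rewrite le_min; apply/andP; split.
  have : q * y1 ^+ 2 <= q * 1 by rewrite ler_wpM2l // ltW.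
  have : (1 - q) * y0 ^+ 2 <= (1 - q) * 1 by rewrite ler_wpM2l //; lra.
  by lra.
have -> : q * y1 ^+ 2 + (1 - q) * y0 ^+ 2 = (1 - q) * (z ^+ 2 / q / L ^+ 2).
  by rewrite /y1 /y0; field; rewrite !lt0r_neq0.
have -> : nn / (2 * d%:R ^+ 2) = 2 * frob A ^+ 2 / nn / L ^+ 2.
  by rewrite /L; field; rewrite !lt0r_neq0 // max_dim_gt0.
apply: (@le_trans _ _ (z ^+ 2 / q / L ^+ 2)).
  by rewrite ler_piMl ?divr_ge0 ?sqr_ge0 ?(ltW p0) //; lra.
by rewrite ler_wpM2r // invr_ge0 sqr_ge0.
Qed.

Lemma expect_walk_sum_centered k : nn / (2 * d%:R) <= k.+2%:R ->
  expect pe (fun w => walk_sum k.+1 (rand_mx centered_entry w)) <=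
  4 * d%:R * (iid_const R * k.+1%:R) ^+ k.+1.
Proof.
move=> hk; have d0 := max_dim_gt0.
pose theta : R := Num.min 1 (nn / (2 * d%:R ^+ 2)).
have th01 : 0 <= theta <= 1.
  by rewrite /theta ge_min lexx /= andbT le_min ler01 divr_ge0 ?mulr_ge0 ?sqr_ge0 // ltW.
have thd : theta * d%:R <= k.+2%:R.
  apply: le_trans hk; apply: (@le_trans _ _ (nn / (2 * d%:R ^+ 2) * d%:R)).
    by rewrite ler_wpM2r ?ler0n // /theta ge_min lexx orbT.
  by rewrite le_eqVlt; apply/orP; left; apply/eqP; field; rewrite lt0r_neq0.
have := @expect_walk_sum_le R k m n d pe (@centered_entry) theta (fun=> 3^-1)
  (fun=> @skew_coin R) th01 thd (leq_maxl m n) (leq_maxr m n)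
  moment1_centered moment_centered_le (@moment1_skew_coin R _) (@moment_skew_coin_ge1 R _).
move=> /le_trans; apply.
apply: (@le_trans _ _ (d%:R / k.+2%:R * (4 * k.+1%:R * (iid_const R * k.+1%:R) ^+ k.+1))).
  by rewrite ler_wpM2l ?divr_ge0 ?ler0n // expect_walk_sum_skew_coin.
rewrite !mulrA ler_wpM2r //.
  by rewrite exprn_ge0 // mulr_ge0 ?ler0n // mulr_ge0 ?exprn_ge0 ?expR_ge0.
have -> : d%:R / k.+2%:R * 4 * k.+1%:R = 4 * d%:R * (k.+1%:R / k.+2%:R) :> R by ring.
rewrite ler_piMr ?mulr_ge0 ?ler0n // ler_pdivrMr ?ltr0n // mul1r ler_nat //.
Qed.

End Sampling.

(** * Conclusion *)

Section Final.
Variable R : realType.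

Lemma markov_bern_prob m n (p : 'I_m -> 'I_n -> R) (W : {ffun 'I_m * 'I_n -> bool} -> R) T E :
  (forall i j, 0 <= p i j <= 1) -> 0 < T -> (forall w, 0 <= W w) -> (forall w, W w < T -> E w) ->
  1 - expect (fun e => p e.1 e.2) W / T <= bern_prob p E.
Proof.
move=> p01 T0 W0 WE; have -> : bern_prob p E =
    expect (fun e => p e.1 e.2) (fun w => if `[< E w >] then 1 else 0) by [].
rewrite -{1}(expect1 (fun e : 'I_m * 'I_n => p e.1 e.2)) [X in _ - X]mulrC -expectZ.
rewrite /expect -sumrB; apply: ler_sum => w _; rewrite -mulrBr; apply: ler_wpM2l.
  by rewrite prodr_ge0 // => e _; have /andP[? ?] := p01 e.1 e.2; case: (w e); rewrite ?subr_ge0.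
case: asboolP => hE; first by rewrite /= lerBlDr lerDl mulr_ge0 // invr_ge0 ltW.
rewrite /= subr_le0 mulrC ler_pdivlMr // mul1r leNgt; apply/negP => /WE; exact: hE.
Qed.

Lemma expR1_le4 : expR 1 <= 4 :> R.
Proof.
have h : 1 / 2 <= expR (- (1 / 2)) :> R by have := expR_ge1Dx (- (1 / 2) : R); lra.
have -> : (1 : R) = 1 / 2 + 1 / 2 by field.
rewrite expRD; move: h; rewrite expRN; have := expR_gt0 (1 / 2 : R).
move: (expR _) => x x0 hx; have x2 : x <= 2.
  by have := ler_wpM2l (ltW x0) hx; rewrite mulfV ?gt_eqF //; lra.
have : x * x <= 2 * 2 by rewrite ler_pM // ltW.
lra.
Qed.

Lemma ln2_ge : 1 / 2 <= ln 2 :> R.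
Proof.
rewrite -ler_expR lnK ?posrE //.
have h : 1 / 2 <= expR (- (1 / 2)) :> R by have := expR_ge1Dx (- (1 / 2) : R); lra.
move: h; rewrite expRN; have := expR_gt0 (1 / 2 : R).
move: (expR _) => x x0 hx.
by have := ler_wpM2l (ltW x0) hx; rewrite mulfV ?gt_eqF //; lra.
Qed.

(** Use [4 <= d ^ 2] and [16 >= e]: the claim reduces to [d ^ 3 <= d ^ (- alpha) * e ^ k]. *)
Lemma failure_prob_le (d k : nat) (alpha : R) : (2 <= d)%N -> 0 < alpha ->
  3 * ((1 + alpha) * ln d%:R) <= k%:R -> 4 * d%:R / 16 ^+ k <= d%:R `^ (- alpha).
Proof.
move=> d2 alpha0 hk; have d0 : 0 < d%:R :> R by rewrite ltr0n ltnW.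
have ln0 : 0 <= ln d%:R :> R by rewrite ln_ge0 // ler1n ltnW.
have dE : d%:R = expR (ln d%:R) :> R by rewrite lnK // posrE.
have h4 : 4 <= expR (2 * ln d%:R) :> R.
  have h : 2 <= d%:R :> R by rewrite ler_nat.
  by rewrite expRM_natl -dE expr2; have := ler_pM (ler0n R 2) (ler0n R 2) h h; lra.
have h16 : expR (k%:R) <= 16 ^+ k :> R.
  rewrite -[k%:R]mulr1 expRM_natl lerXn2r ?nnegrE ?expR_ge0 //.
  by have := expR1_le4; lra.
have powE : d%:R `^ (- alpha) = expR (- alpha * ln d%:R) :> R.
  by rewrite /powR gt_eqF.
rewrite powE ler_pdivrMr ?exprn_gt0 //.
apply: (@le_trans _ _ (expR (2 * ln d%:R) * expR (ln d%:R))).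
  by rewrite -dE ler_wpM2r // ltW.
apply: (@le_trans _ _ (expR (- alpha * ln d%:R) * expR k%:R)); last first.
  by rewrite ler_wpM2l ?expR_ge0.
rewrite -!expRD ler_expR; have := mulr_ge0 (ltW alpha0) ln0; lra.
Qed.

Lemma svals_svd m n (A : 'M[R]_(m, n)) : exists U V, is_svd A U V (svals A).
Proof.
apply: (ClassicalEpsilon.epsilon_spec (inhabits (fun _ : nat => 0))
  (fun s => exists U V, is_svd A U V s)).
by have [U [V [s h]]] := svd_exists A; exists s, U, V.
Qed.

Lemma frob_perturbation_le m n (A M B Ar : 'M[R]_(m, n)) (eta : R) r :
  let delta := sigma A r - sigma A r.+1 in
  (0 < r)%N -> 0 < delta -> 0 <= eta -> eta <= delta / 4 ->
  opnorm_le (M - A) eta -> opnorm_le (M - A)^T eta ->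
  best_rank_approx r M B -> best_rank_approx r A Ar ->
  frob (B - Ar) <= 4 * Num.sqrt r%:R * eta *
    (1 + Num.sqrt (sigma A r.+1 * sigma A 1) / delta).
Proof.
move=> delta r0 delta0 eta0 eta_le hE hEt hB hAr.
have [U [V hA]] := svals_svd A; have [U' [V' [s' hM]]] := svd_exists M.
have [_ s0 _ smin _] := hA; set s := svals A in s0 smin hA.
have sE : delta = s r.-1 - s r by [].
(* The gap makes the [r]-th singular value of [A] positive, so [r] is at most both dimensions
   although only [r < d] is assumed in the end. *)
have rmin : (r <= minn m n)%N.
  rewrite leqNgt; apply/negP => h; have sr0 : s r.-1 = 0 by apply: smin; lia.
  by have := s0 r; move: delta0; rewrite sE sr0; lra.
have gapA : s r < s r.-1 by rewrite -subr_gt0 -sE.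
(* Weyl in both directions leaves [M] a gap of at least [delta / 2], so its best approximation is
   also its truncation. *)
have gapM : s' r < s' r.-1.
  have h1 := weyl_singular_values r hA hM eta0 hE.
  have hE' : opnorm_le (A - M) eta by move=> x; rewrite -opprB mulNmx nf2N.
  have h2 := weyl_singular_values r.-1 hM hA eta0 hE'.
  by move: delta0 eta_le h1 h2; rewrite sE; lra.
rewrite (best_rank_approx_svd hM hB r0 rmin gapM) (best_rank_approx_svd hA hAr r0 rmin gapA).
have main := svd_trunc_perturbation hA hM eta0 hE hEt r0 rmin sE delta0 eta_le.
have X0 : 0 <= Num.sqrt (sigma A r.+1 * sigma A 1) / delta by rewrite divr_ge0 ?sqrtr_ge0 // ltW.
rewrite frob_le; last by rewrite !mulr_ge0 ?sqrtr_ge0 // addr_ge0.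
apply: (le_trans main).
have -> : (4 * Num.sqrt r%:R * eta * (1 + Num.sqrt (sigma A r.+1 * sigma A 1) / delta)) ^+ 2 =
    16 * r%:R * eta ^+ 2 * (1 + Num.sqrt (sigma A r.+1 * sigma A 1) / delta) ^+ 2.
  rewrite !exprMn sqr_sqrtr ?ler0n //; ring.
rewrite ler_wpM2l ?mulr_ge0 ?sqr_ge0 ?ler0n //.
(* The sharper ratio [s r / delta] is relaxed to the stated one by [s r <= s 0]. *)
have hx : s r / delta <= Num.sqrt (sigma A r.+1 * sigma A 1) / delta.
  rewrite ler_wpM2r ?invr_ge0 ?(ltW delta0) // /sigma /= -/s.
  rewrite -[leLHS]ger0_norm // -sqrtr_sqr ler_wsqrtr // expr2 ler_wpM2l //.
  exact: svd_mono hA _ _ (leq0n r).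
have x0 : 0 <= s r / delta by rewrite divr_ge0 // ltW.
have := lerXn2r 2 x0 X0 hx; move: X0.
by move: (s r / delta) (Num.sqrt _ / delta) => x X; lra.
Qed.

End Final.

Theorem theorem1 (R : realType) :
  exists C1 C2 : R, 0 < C1 /\ 0 < C2 /\
  forall (d1 d2 : nat) (A : 'M[R]_(d1, d2)) (n : R) (r : nat) (alpha : R),
    let d := maxn d1 d2 in
    0 < n -> (1 <= r)%N -> (r < d)%N ->
    sigma A r.+1 < sigma A r ->
    0 < alpha ->
    n >= C2 * d%:R * Num.max ((1 + alpha) * ln (d%:R))
                      (frob A ^+ 2 / (sigma A r - sigma A r.+1) ^+ 2) ->
    bern_prob (samp_prob A n)
      (fun w => forall B Ar : 'M[R]_(d1, d2),
         best_rank_approx r (P_Omega A (samp_prob A n) w) B ->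
         best_rank_approx r A Ar ->
         frob (B - Ar) <=
           C1 * frob A * Num.sqrt (r%:R * d%:R / n) *
           (1 + Num.sqrt (sigma A r.+1 * sigma A 1) / (sigma A r - sigma A r.+1)))
    >= 1 - (d%:R) `^ (- alpha).
Proof.
pose c := iid_const R.
have c0 : 0 < c by rewrite mulr_gt0 ?exprn_gt0 ?expR_gt0.
(* The 32 is the one in [eta], the error norm bound [L * sqrt (16 * c * q)], and 4 is the
   perturbation constant. In the second witness, 10 makes the walks long enough for the failure
   probability and [512 * c] is exactly [eta <= delta / 4]. *)
exists (4 * Num.sqrt (32 * c)), (10 + 512 * c).
split; first by rewrite mulr_gt0 // sqrtr_gt0 mulr_gt0.
split; first by rewrite addr_gt0 // mulr_gt0.
move=> d1 d2 A n r alpha d n0 r1 rd gap alpha0 hn.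
set delta := sigma A r - sigma A r.+1.
have delta0 : 0 < delta by rewrite subr_gt0.
have dge2 : (2 <= d)%N by exact: leq_trans rd.
have dpos : 0 < d%:R :> R by rewrite ltr0n ltnW.
(* A zero matrix has no singular value gap. *)
have F0 : 0 < frob A.
  rewrite lt_def frob_ge0 andbT; apply: contraTneq gap => F0.
  have A0 : A = 0 by apply: nf2_eq0; rewrite -sqr_frob F0 expr0n.
  have [U [V hA]] := svals_svd A.
  have rk : (\rank A <= 0)%N by rewrite A0 mxrank0.
  by rewrite /sigma !(svd_rank_eq0 hA rk) // ltxx.
have hn1 : (10 + 512 * c) * d%:R * ((1 + alpha) * ln d%:R) <= n.
  apply: le_trans hn; apply: ler_wpM2l; last by rewrite le_max lexx.
  by rewrite mulr_ge0 ?ler0n // addr_ge0 // mulr_ge0 // ltW.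
have hn2 : (10 + 512 * c) * d%:R * (frob A ^+ 2 / delta ^+ 2) <= n.
  apply: le_trans hn; apply: ler_wpM2l; last by rewrite le_max lexx orbT.
  by rewrite mulr_ge0 ?ler0n // addr_ge0 // mulr_ge0 // ltW.
pose t := (1 + alpha) * ln (d%:R : R).
have tge : 1 / 2 <= t.
  have h2 : 1 / 2 <= ln (d%:R : R).
    by apply: (le_trans (ln2_ge R)); rewrite ler_ln ?posrE // ler_nat.
  have h3 : 0 <= alpha * ln (d%:R : R) by apply: mulr_ge0 (ltW alpha0) (le_trans _ h2); lra.
  by rewrite /t; lra.
pose q := n / (2 * d%:R).
have q5t : 5 * t <= q.
  rewrite /q ler_pdivlMr ?mulr_gt0 //; apply: le_trans hn1; rewrite -/t.
  have t0 : 0 <= t by lra.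
  have := mulr_ge0 (mulr_ge0 (mulr_ge0 (ler0n R 512) (ltW c0)) (ltW dpos)) t0.
  lra.
have q1 : 1 <= q by lra.
(* The number [k.+1] of row visits is the integer part of [q]. Since [q >= 5 t] and [t >= 1 / 2], it
   exceeds [5 t - 1 >= 3 t], as the failure bound requires. *)
have [k kE] : exists k, Num.truncn q = k.+1.
  have : (0 < Num.truncn q)%N by rewrite truncn_gt0.
  by case: (Num.truncn q) => // k _; exists k.
have kq : k.+1%:R <= q by rewrite -kE truncn_le; lra.
have qk : q < k.+2%:R by rewrite -kE truncnS_gt.
(* The threshold exceeds the moment bound by [16 ^ k.+1], up to the factor [4 * d]; taking roots
   costs only a constant in the norm. *)
pose T := (16 * c * k.+1%:R) ^+ k.+1.
have K0 : 0 < k.+1%:R :> R by rewrite ltr0n.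
have T0 : 0 < T by rewrite exprn_gt0 // mulr_gt0 // mulr_gt0.
pose W w := walk_sum k.+1 (rand_mx (centered_entry A n) w).
have EW := expect_walk_sum_centered n0 F0 (ltW qk).
apply: (@le_trans _ _ (1 - expect (fun e => samp_prob A n e.1 e.2) W / T)).
  rewrite lerD2l lerN2.
  apply: (@le_trans _ _ (4 * d%:R / 16 ^+ k.+1)); last first.
    apply: failure_prob_le => //; rewrite -/t.
    by move: qk; rewrite -natr1; lra.
  rewrite ler_pdivrMr //; apply: (le_trans EW).
  have -> : T = 16 ^+ k.+1 * (c * k.+1%:R) ^+ k.+1 by rewrite /T -mulrA exprMn.
  by rewrite mulrA divfK // expf_neq0 ?pnatr_eq0.
apply: markov_bern_prob => //.
- by move=> i j; apply: samp_prob01.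
- by move=> w; apply: walk_sum_ge0.
move=> w hW B Ar hB hAr.
pose L := 2 * d%:R * frob A / n.
have L0 : 0 < L by rewrite divr_gt0 // !mulr_gt0.
pose eta := frob A * Num.sqrt (32 * c * d%:R / n).
have eta0 : 0 <= eta by rewrite mulr_ge0 ?frob_ge0 ?sqrtr_ge0.
have eta2 : eta ^+ 2 = frob A ^+ 2 * (32 * c * d%:R / n).
  rewrite /eta exprMn; congr (_ * _); rewrite sqr_sqrtr //; apply: divr_ge0; last exact: ltW.
  by rewrite mulr_ge0 ?ler0n // mulr_ge0 // ltW.
pose X := rand_mx (centered_entry A n) w.
have [U [V [s hX]]] := svd_exists X; have [_ s0 _ _ _] := hX.
have s2 : s 0%N ^+ 2 <= 16 * c * q.
  apply: (@le_trans _ _ (16 * c * k.+1%:R)); last by rewrite ler_wpM2l // mulr_ge0 ?ltW.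
  have b0 : 0 <= 16 * c * k.+1%:R by rewrite mulr_ge0 ?ler0n // mulr_ge0 // ltW.
  rewrite -(@ler_pXn2r _ k.+1) ?nnegrE ?sqr_ge0 // -exprM.
  exact: le_trans (walk_sum_ge k hX) (ltW hW).
have EX : P_Omega A (samp_prob A n) w - A = L *: X.
  by rewrite /X rand_mx_centered scalerA mulfV ?scale1r // lt0r_neq0.
have scale_op m1 n1 (Y : 'M[R]_(m1, n1)) : opnorm_le Y (s 0%N) -> opnorm_le (L *: Y) eta.
  move=> hY x; rewrite -scalemxAl nf2Z.
  apply: (@le_trans _ _ (L ^+ 2 * (s 0%N ^+ 2 * nf2 x))).
    by rewrite ler_wpM2l ?sqr_ge0.
  rewrite mulrA ler_wpM2r ?nf2_ge0 // eta2.
  apply: (@le_trans _ _ (L ^+ 2 * (16 * c * q))); first by rewrite ler_wpM2l ?sqr_ge0.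
  rewrite le_eqVlt; apply/orP; left; apply/eqP; rewrite /L /q; field.
  by rewrite !lt0r_neq0.
have hE : opnorm_le (P_Omega A (samp_prob A n) w - A) eta.
  by rewrite EX; apply: scale_op; exact: svd_opnorm_le hX (lexx _).
have hEt : opnorm_le (P_Omega A (samp_prob A n) w - A)^T eta.
  by rewrite EX linearZ /=; apply: scale_op; exact: svd_opnorm_le (svd_tr hX) (lexx _).
have eta_le : eta <= delta / 4.
  rewrite -(@ler_pXn2r _ 2) ?nnegrE //; last by rewrite divr_ge0 // ltW.
  rewrite eta2 (_ : (delta / 4) ^+ 2 = delta ^+ 2 / 16); last by field.
  have D0 : 0 < delta ^+ 2 by rewrite exprn_gt0.
  have h3 : 512 * c * d%:R * frob A ^+ 2 <= n * delta ^+ 2.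
    rewrite -ler_pdivrMr //; apply: le_trans hn2.
    have : 0 <= d%:R * (frob A ^+ 2 / delta ^+ 2).
      by rewrite mulr_ge0 ?ler0n // divr_ge0 ?sqr_ge0.
    by lra.
  rewrite ler_pdivlMr //.
  have -> : frob A ^+ 2 * (32 * c * d%:R / n) * 16 = 512 * c * d%:R * frob A ^+ 2 / n.
    by field; rewrite lt0r_neq0.
  by rewrite ler_pdivrMr // [leRHS]mulrC.
apply: (le_trans (frob_perturbation_le r1 delta0 eta0 eta_le hE hEt hB hAr)).
rewrite -/delta; apply: ler_wpM2r.
  by rewrite addr_ge0 // divr_ge0 ?sqrtr_ge0 // ltW.
have e1 : Num.sqrt (32 * c * d%:R / n) = Num.sqrt (32 * c) * Num.sqrt (d%:R / n).
  by rewrite -mulrA sqrtrM // mulr_ge0 // ltW.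
have e2 : Num.sqrt (r%:R * d%:R / n) = Num.sqrt r%:R * Num.sqrt (d%:R / n).
  by rewrite -mulrA sqrtrM.
rewrite /eta e1 e2 le_eqVlt; apply/orP; left; apply/eqP; ring.
Qed.
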